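(* Let $u:\Sigma\to S^n$ be a minimal immersion of a surface and let $M\subset\mathbb{R}^{n+1}$ be a twisted cone over its image, defined by data $(f,w)$. Let $m:\Sigma\to\mathbb{R}$ satisfy $\Delta m=-2m$. Then $(M,\mu)$ is a twisted-austere pair, for $\tan\phi=0$, where $$\mu=m\,( *df)-f\,( *dm)+d(tm).$$
   Context: Twisted cone (Bryant): let $u:\Sigma\to S^n\subset\mathbb{R}^{n+1}$ be a minimal immersion of a surface, and give $\Sigma$ the induced metric, with Laplacian $\Delta=\operatorname{div}\nabla$ and Hodge star $*$. Let $f:\Sigma\to\mathbb{R}$ satisfy $\Delta f=-2f$. Then the $\mathbb{R}^{n+1}$-valued $1$-form $\beta=u\,( *df)-f\,( *du)$ is closed; let $w:\Sigma\to\mathbb{R}^{n+1}$ satisfy $dw=\beta$ (passing to the universal cover of $\Sigma$ if necessary). The twisted cone defined by the data $(f,w)$ is the immersed $3$-fold $M$ parametrized by $X(p,t)=w(p)+t\,u(p)$, $p\in\Sigma$, $t\in\mathbb{R}^+$. The $1$-form $\mu$ in the claim is on $\Sigma\times\mathbb{R}^+$, with $f,m$ and their differentials pulled back from $\Sigma$. Identify $T^*\mathbb{R}^N$ with $\mathbb{C}^N$ via $(x,\sum_j y_j\,dx_j)\leftrightarrow (z_j=x_j+iy_j)$. An $N$-dimensional submanifold $L\subset\mathbb{C}^N$ is special Lagrangian with phase $e^{i\theta}$ if both $\sum_j dx_j\wedge dy_j$ and $\operatorname{Im}(e^{i\theta}dz_1\wedge\cdots\wedge dz_N)$ restrict to zero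 on $L$. For a submanifold $M\subset\mathbb{R}^N$ and a smooth $1$-form $\mu$ on $M$, using $T^*\mathbb{R}^N|_M=T^*M\oplus N^*M$ set $N^*M+\mu=\{(x,\xi+\mu_x): x\in M,\ \xi\in N^*_xM\}$. The pair $(M,\mu)$ is twisted-austere (with phase $e^{i\theta}$) if $N^*M+\mu$ is special Lagrangian (with phase $e^{i\theta}$). Here $N=n+1$, $\dim M=3$, and the cophase is $\phi=\theta-(N-3)\frac{\pi}{2}=\theta-(n-2)\frac{\pi}{2}$. It is a known fact (Karigiannis-Leung) that, with $B=\nabla\mu$, $C=I+iB$ and $A^\nu=\nu\cdot\mathrm{II}$ (matrices in an orthonormal tangent frame), this is equivalent to: $d\mu=0$, $\operatorname{Im}(e^{i\phi}\det C)=0$, and $\operatorname{Im}(i^j\sigma_j(A^\nu C^{-1}))=0$ for all normal $\nu$ and $j=1,2,3$, where $\sigma_j$ is the $j$-th elementary symmetric function of the eigenvalues. *)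

(* Defs.v *)
From HB Require Import structures.
From mathcomp Require Import all_boot all_order all_algebra.
From mathcomp Require Import complex.
From mathcomp Require Import all_classical all_reals all_analysis.

Set Implicit Arguments.
Unset Strict Implicit.
Unset Printing Implicit Defensive.

Import Order.TTheory GRing.Theory Num.Theory.
Import numFieldNormedType.Exports.

Local Open Scope classical_set_scope.
Local Open Scope ring_scope.

Definition dot (R : realType) (k : nat) (a b : 'rV[R]_k) : R :=
  \sum_i a 0 i * b 0 i.

Definition partial (R : realType) (k : nat) (V : normedModType R)
    (f : 'rV[R]_k.+1 -> V) (x : 'rV[R]_k.+1) (i : 'I_k.+1) : V :=
  'D_(delta_mx 0 i) f x.

Fixpoint Ck_on (R : realType) (k : nat) (V : normedModType R) (r : nat)
    (D : set 'rV[R]_k.+1) (f : 'rV[R]_k.+1 -> V) : Prop :=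
  match r with
  | 0 => forall x, D x -> {for x, continuous f}
  | r'.+1 => (forall x, D x -> differentiable f x) /\
             (forall i, Ck_on r' D (fun x => partial f x i))
  end.

Definition smooth_on (R : realType) (k : nat) (V : normedModType R)
    (D : set 'rV[R]_k.+1) (f : 'rV[R]_k.+1 -> V) : Prop :=
  forall r, Ck_on r D f.

Definition immersion_at (R : realType) (k n : nat)
    (X : 'rV[R]_k.+1 -> 'rV[R]_n.+1) (q : 'rV[R]_k.+1) : bool :=
  row_free (\matrix_(i < k.+1) partial X q i).

Record chart (R : realType) (T : topologicalType) := Chart {
  chart_dom : set T;
  chart_map : T -> 'rV[R]_2;
  chart_inv : 'rV[R]_2 -> T;
  chart_dom_open : open chart_dom;
  chart_img_open : open (chart_map @` chart_dom);
  chart_mapK : forall p, chart_dom p -> chart_inv (chart_map p) = p;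
  chart_map_cont : {within chart_dom, continuous chart_map};
  chart_inv_cont : {within chart_map @` chart_dom, continuous chart_inv}
}.

Definition chart_img (R : realType) (T : topologicalType) (c : chart R T) :
  set 'rV[R]_2 := chart_map c @` chart_dom c.

Record oriented_surface (R : realType) := OrientedSurface {
  surface_space :> topologicalType;
  atlas : set (chart R surface_space);
  surface_hausdorff : hausdorff_space surface_space;
  surface_second_countable : @second_countable surface_space;
  atlas_cover : forall p, exists2 c, atlas c & chart_dom c p;
  atlas_smooth : forall c d, atlas c -> atlas d ->
    smooth_on (chart_map c @` (chart_dom c `&` chart_dom d))
      (chart_map d \o chart_inv c);
  atlas_oriented : forall c d, atlas c -> atlas d ->
    forall x, (chart_map c @` (chart_dom c `&` chart_dom d)) x ->
    0 < \det (\matrix_(i < 2) partial (chart_map d \o chart_inv c) x i)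
}.

Definition loc (R : realType) (S : oriented_surface R) (V : Type)
    (c : chart R S) (h : S -> V) : 'rV[R]_2 -> V := h \o chart_inv c.

Definition smooth (R : realType) (S : oriented_surface R)
    (V : normedModType R) (h : S -> V) : Prop :=
  forall c, atlas c -> smooth_on (chart_img c) (loc c h).

(** A V-valued 1-form is given by its components in each chart. *)
Definition form1 (R : realType) (S : oriented_surface R) (V : Type) :=
  chart R S -> 'rV[R]_2 -> 'I_2 -> V.

Definition ext_d (R : realType) (S : oriented_surface R)
    (V : normedModType R) (h : S -> V) : form1 S V :=
  fun c x i => partial (loc c h) x i.

Definition metric (R : realType) (S : oriented_surface R) (n : nat)
    (u : S -> 'rV[R]_n.+1) (c : chart R S) (x : 'rV[R]_2) : 'M[R]_2 :=
  \matrix_(i, j) dot (ext_d u c x i) (ext_d u c x j).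

Definition inv_metric (R : realType) (S : oriented_surface R) (n : nat)
    (u : S -> 'rV[R]_n.+1) (c : chart R S) (x : 'rV[R]_2) : 'M[R]_2 :=
  invmx (metric u c x).

Definition vol (R : realType) (S : oriented_surface R) (n : nat)
    (u : S -> 'rV[R]_n.+1) (c : chart R S) (x : 'rV[R]_2) : R :=
  Num.sqrt (\det (metric u c x)).

Definition levi_civita (R : realType) : 'M[R]_2 :=
  \matrix_(j, k) ((j < k)%N%:R - (k < j)%N%:R).

(** Convention: [alpha /\ hodge alpha = |alpha|^2 dA], so that
    [*e1 = e2] and [*e2 = - e1] in an oriented orthonormal coframe. *)
Definition hodge (R : realType) (S : oriented_surface R) (n : nat)
    (u : S -> 'rV[R]_n.+1) (V : normedModType R) (alpha : form1 S V) :
    form1 S V :=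
  fun c x k => vol u c x *:
    \sum_i \sum_j (inv_metric u c x i j * levi_civita R j k) *: alpha c x i.

Definition gradient (R : realType) (S : oriented_surface R) (n : nat)
    (u : S -> 'rV[R]_n.+1) (h : S -> R) (c : chart R S) (x : 'rV[R]_2)
    (i : 'I_2) : R :=
  \sum_j inv_metric u c x i j * ext_d h c x j.

Definition divergence (R : realType) (S : oriented_surface R) (n : nat)
    (u : S -> 'rV[R]_n.+1) (c : chart R S)
    (Y : 'rV[R]_2 -> 'I_2 -> R) (x : 'rV[R]_2) : R :=
  (vol u c x)^-1 * \sum_i partial (fun y => vol u c y * Y y i) x i.

Definition laplacian (R : realType) (S : oriented_surface R) (n : nat)
    (u : S -> 'rV[R]_n.+1) (h : S -> R) (c : chart R S) (x : 'rV[R]_2) : R :=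
  divergence u c (gradient u h c) x.

Definition eigenfunction2 (R : realType) (S : oriented_surface R) (n : nat)
    (u : S -> 'rV[R]_n.+1) (h : S -> R) : Prop :=
  smooth h /\
  forall c, atlas c -> forall x, chart_img c x ->
    laplacian u h c x = - 2 * loc c h x.

(** [nu] ranges over the normal space of the surface inside T S^n; since the
    Levi-Civita connection of S^n is the tangential part of the flat one,
    [dot nu (d_i d_j u)] are the components of the second fundamental form
    in the direction [nu], and the sum is its trace. *)
Definition zero_mean_curvature (R : realType) (S : oriented_surface R)
    (n : nat) (u : S -> 'rV[R]_n.+1) : Prop :=
  forall c, atlas c -> forall x, chart_img c x ->
  forall nu : 'rV[R]_n.+1, dot nu (loc c u x) = 0 ->
    (forall i, dot nu (ext_d u c x i) = 0) ->
    \sum_i \sum_j inv_metric u c x i j *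
      dot nu (partial (fun y => ext_d u c y j) x i) = 0.

Definition minimal_immersion (R : realType) (S : oriented_surface R)
    (n : nat) (u : S -> 'rV[R]_n.+1) : Prop :=
  [/\ smooth u,
      forall p, dot (u p) (u p) = 1,
      forall c, atlas c -> forall x, chart_img c x ->
        immersion_at (loc c u) x
    & zero_mean_curvature u].

Section twisted_austere.
Variables (R : realType) (k n : nat).

(** A tangent vector of C^(n+1) is a pair (dx, dy). *)
Let vec := ('rV[R]_n.+1 * 'rV[R]_n.+1)%type.

Definition omega (v v' : vec) : R := dot v.1 v'.2 - dot v.2 v'.1.

Definition dz (v : 'I_n.+1 -> vec) : R[i] :=
  \det (\matrix_(a, j) Complex ((v a).1 0 j) ((v a).2 0 j)).

Definition expi (theta : R) : R[i] := Complex (cos theta) (sin theta).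

Definition special_lagrangian_plane (theta : R) (T : set vec) : Prop :=
  (forall v v', T v -> T v' -> omega v v' = 0) /\
  (forall v, (forall a, T (v a)) -> complex.Im (expi theta * dz v) = 0).

Variables (D : set 'rV[R]_k.+1) (X : 'rV[R]_k.+1 -> 'rV[R]_n.+1)
  (mu : 'rV[R]_k.+1 -> 'I_k.+1 -> R).

Definition conormal (q : 'rV[R]_k.+1) (xi : 'rV[R]_n.+1) : Prop :=
  forall i, dot xi (partial X q i) = 0.

(** The covector [mu] at [q], seen in the summand T^*M of T^*R^(n+1)|_M:
    the tangential vector representing [mu] for the Euclidean metric. *)
Definition tangential_rep (q : 'rV[R]_k.+1) (tau : 'rV[R]_n.+1) : Prop :=
  (exists a : 'I_k.+1 -> R, tau = \sum_i a i *: partial X q i) /\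
  (forall i, dot tau (partial X q i) = mu q i).

(** N^*M + mu, for M parametrized by [X] on [D], as the set of pairs (q, y)
    mapped to C^(n+1) by (q, y) |-> X q + i y. *)
Definition shifted_conormal : set ('rV[R]_k.+1 * 'rV[R]_n.+1) :=
  [set p | D p.1 /\ exists xi tau,
    [/\ conormal p.1 xi, tangential_rep p.1 tau & p.2 = xi + tau]].

(** Tangent vectors of N^*M + mu are the velocities of curves in it. *)
Definition shifted_conormal_tangent (p : 'rV[R]_k.+1 * 'rV[R]_n.+1) :
    set vec :=
  [set v | exists (q : R -> 'rV[R]_k.+1) (y : R -> 'rV[R]_n.+1),
    [/\ (q 0, y 0) = p,
        \forall s \near (0 : R), shifted_conormal (q s, y s),
        derivable q 0 1, derivable y 0 1
      & v = ('D_1 (X \o q) 0, 'D_1 y 0)]].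

(** As [X] is an immersion, N^*M + mu has dimension n + 1. *)
Definition twisted_austere_patch (theta : R) : Prop :=
  (forall q, D q -> immersion_at X q) /\
  (forall p, shifted_conormal p ->
    special_lagrangian_plane theta (shifted_conormal_tangent p)).

End twisted_austere.

Section cylinder.
Variables (R : realType) (S : oriented_surface R).

Definition base (q : 'rV[R]_3) : 'rV[R]_2 := @lsubmx R 1 2 1 q.
Definition height (q : 'rV[R]_3) : R := q 0 ord_max.

Definition cyl_img (c : chart R S) : set 'rV[R]_3 :=
  [set q | chart_img c (base q) /\ 0 < height q].

Definition cyl_loc (V : Type) (c : chart R S) (h : S * R -> V) :
    'rV[R]_3 -> V :=
  fun q => h (chart_inv c (base q), height q).

Definition cyl_form1 := chart R S -> 'rV[R]_3 -> 'I_3 -> R.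

Definition cyl_d (h : S * R -> R) : cyl_form1 :=
  fun c q i => partial (cyl_loc c h) q i.

Definition cyl_pullback (alpha : form1 S R) : cyl_form1 :=
  fun c q i => match @fintype.split 2 1 i with
               | inl j => alpha c (base q) j
               | inr _ => 0
               end.

(** Being special Lagrangian is a local condition, so it is imposed on every
    patch of the immersed 3-fold [X] : S x R^+ -> R^(n+1). *)
Definition twisted_austere (n : nat) (X : S * R -> 'rV[R]_n.+1)
    (mu : cyl_form1) (theta : R) : Prop :=
  forall c, atlas c ->
    twisted_austere_patch (cyl_img c) (cyl_loc c X) (mu c) theta.

End cylinder.

Definition twisted_cone_data (R : realType) (S : oriented_surface R)
    (n : nat) (u : S -> 'rV[R]_n.+1) (f : S -> R) (w : S -> 'rV[R]_n.+1) :
    Prop :=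
  [/\ eigenfunction2 u f, smooth w
    & forall c, atlas c -> forall x, chart_img c x -> forall i,
      ext_d w c x i = hodge u (ext_d f) c x i *: loc c u x
                      - loc c f x *: hodge u (ext_d u) c x i].

Definition twisted_cone (R : realType) (S : oriented_surface R) (n : nat)
    (u w : S -> 'rV[R]_n.+1) : S * R -> 'rV[R]_n.+1 :=
  fun p => w p.1 + p.2 *: u p.1.

Definition cone_form (R : realType) (S : oriented_surface R) (n : nat)
    (u : S -> 'rV[R]_n.+1) (f m : S -> R) : cyl_form1 S :=
  fun c q i =>
    cyl_pullback (fun c x j => loc c m x * hodge u (ext_d f) c x j
                               - loc c f x * hodge u (ext_d m) c x j) c q i
    + cyl_d (fun p => p.2 * m p.1) c q i.

Definition cophase (R : realType) (n : nat) (theta : R) : R :=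
  theta - (n.+1%:R - 3) * (pi / 2).

(* Main.v *)
(** For y in the fibre of N^*M + mu over (p, t), the tangential part of y is
    m u + grad m, independently of t; so the fibre is cut out by the equations
    y . u = m and y . d_i u = d_i m at p.  Differentiating them along a curve,
    a velocity (dx, dy) satisfies dy . u = 0 and dy . d_i u = sum_j S_ij a_j,
    where a is the velocity of p and S_ij = d_i d_j m - y . d_i d_j u is
    symmetric, and trace free for the induced metric g because
    Delta m = - 2 m and u is minimal.  Moreover dx is, up to a multiple of u,
    the image of a under L = t - f *, where * is the Hodge star of the surface.
    Since * is skew and S is symmetric and trace free, L S is symmetric, which
    gives the vanishing of omega, and det (L g + i S) is real, which gives the
    condition on the phase. *)
Require Import Defs.
From mathcomp Require Import all_boot all_order all_algebra.
From mathcomp Require Import ring.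
From mathcomp Require Import complex.
From mathcomp Require Import all_classical all_reals all_analysis.

Set Implicit Arguments.
Unset Strict Implicit.
Unset Printing Implicit Defensive.

Import Order.TTheory GRing.Theory Num.Theory.
Import numFieldNormedType.Exports.

Local Open Scope classical_set_scope.
Local Open Scope ring_scope.

(** * Directional derivatives *)

Lemma diff_is_derive (R : realType) (V W : normedModType R) (f : V -> W) x v :
  differentiable f x -> is_derive x v f ('d f x v).
Proof.
by move=> df; apply: DeriveDef; [exact: diff_derivable|rewrite deriveE].
Qed.

Lemma is_derive_mxE (R : realType) (V : normedModType R) m n
    (f : V -> 'M[R]_(m, n)) x v (df : 'M[R]_(m, n)) i j :
  is_derive x v f df -> is_derive x v (fun y => f y i j) (df i j).
Proof.
move=> [dv <-]; rewrite derive_mx// mxE.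
by apply/derivableP; move/derivable_mxP : dv; exact.
Qed.

Lemma is_derive_mxP (R : realType) (V : normedModType R) m n
    (f : V -> 'M[R]_(m, n)) x v (df : 'M[R]_(m, n)) :
  (forall i j, is_derive x v (fun y => f y i j) (df i j)) ->
  is_derive x v f df.
Proof.
move=> H; have dv : derivable f x v by apply/derivable_mxP => i j; case: (H i j).
apply: DeriveDef => //; apply/matrixP => i j.
by rewrite derive_mx// mxE; exact: derive_val.
Qed.

Lemma is_derive_dot (R : realType) (V : normedModType R) n
    (f g : V -> 'rV[R]_n) x v df dg :
  is_derive x v f df -> is_derive x v g dg ->
  is_derive x v (fun y => dot (f y) (g y)) (dot df (g x) + dot (f x) dg).
Proof.
move=> fx gx.
have -> : (fun y => dot (f y) (g y)) =
    \sum_(i < n) ((fun y => f y 0 i) * (fun y => g y 0 i)).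
  by apply/funext => y; rewrite fct_sumE.
have H i : is_derive x v ((fun y => f y 0 i) * (fun y => g y 0 i))
    (df 0 i * g x 0 i + f x 0 i * dg 0 i).
  have h1 := is_derive_mxE 0 i fx; have h2 := is_derive_mxE 0 i gx.
  apply: is_derive_eq; rewrite /GRing.scale/=; ring.
by have := is_derive_sum H; rewrite big_split.
Qed.

Lemma is_derive_scale (R : realType) (V : normedModType R) n
    (h : V -> R) (f : V -> 'rV[R]_n) x v dh df :
  is_derive x v h dh -> is_derive x v f df ->
  is_derive x v (fun y => h y *: f y) (dh *: f x + h x *: df).
Proof.
move=> hx fx; apply: is_derive_mxP => i j.
have fxij := is_derive_mxE i j fx.
have -> : (fun y => (h y *: f y) i j) = h * (fun y => f y i j).
  by apply/funext => y; rewrite mxE.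
by apply: is_derive_eq; rewrite !mxE /GRing.scale/=; ring.
Qed.

Lemma is_derive_comp_real (R : realType) (V : normedModType R)
    (f : V -> R) (g : R -> R) x v dg :
  differentiable f x -> is_derive (f x) 1 g dg ->
  is_derive x v (g \o f) (dg * 'D_v f x).
Proof.
move=> df [dg1 <-]; have dgx : differentiable g (f x) by exact/derivable1_diffP.
have -> : 'D_1 g (f x) * 'D_v f x = 'd (g \o f) x v.
  rewrite diff_comp//= !deriveE// -[in RHS](mulr1 ('d f x v)).
  by rewrite [in RHS]linearZ/= mulrC.
exact/diff_is_derive/differentiable_comp.
Qed.

(** The chain rule in coordinates: the velocity is expanded in the standard basis and the
    differential of [g] is linear. *)
Lemma is_derive_curve (R : realType) k (W : normedModType R)
    (g : 'rV[R]_k.+1 -> W) (q : R -> 'rV[R]_k.+1) t :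
  differentiable g (q t) -> derivable q t 1 ->
  is_derive t 1 (g \o q) (\sum_i ('D_1 q t) 0 i *: partial g (q t) i).
Proof.
move=> dg dq1; have dq : differentiable q t by exact/derivable1_diffP.
suff <- : 'd (g \o q) t 1 = \sum_i ('D_1 q t) 0 i *: partial g (q t) i.
  exact/diff_is_derive/differentiable_comp.
have e : 'd q t 1 = 'D_1 q t by rewrite deriveE.
rewrite diff_comp//= e [in LHS](row_sum_delta ('D_1 q t)) linear_sum.
by apply: eq_bigr => i _; rewrite linearZ/=; congr (_ *: _); rewrite -deriveE.
Qed.

(** As [base] is linear, the difference quotient of [g \o base] along [v] is literally that of [g]
    along [base v]. *)
Lemma is_derive_base (R : realType) (W : normedModType R) (g : 'rV[R]_2 -> W)
    (q v : 'rV[R]_3) dg :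
  is_derive (base q) (base v) g dg -> is_derive q v (g \o @base R) dg.
Proof.
have e : (fun h => h^-1 *: (((g \o @base R) \o shift q) (h *: v)
      - (g \o @base R) q)) =
    (fun h => h^-1 *: ((g \o shift (base q)) (h *: base v) - g (base q))).
  apply/funext => h /=; congr (_ *: (g _ - _)).
  by apply/rowP => j; rewrite !mxE.
by move=> [H1 H2]; apply: DeriveDef; [rewrite /derivable e | rewrite /derive e].
Qed.

Lemma is_derive_height (R : realType) (q v : 'rV[R]_3) :
  is_derive q v (@height R) (height v).
Proof. by apply: (@is_derive_mxE _ _ _ _ id q v v 0 ord_max); exact: is_derive_id. Qed.

Lemma base_delta (R : realType) (i : 'I_2) :
  base (delta_mx 0 (lshift 1 i) : 'rV[R]_3) = delta_mx 0 i.
Proof.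
by apply/rowP => j; rewrite !mxE/= (inj_eq (@lshift_inj _ _)).
Qed.

Lemma base_delta_max (R : realType) : base (delta_mx 0 ord_max : 'rV[R]_3) = 0.
Proof.
by apply/rowP => j; rewrite !mxE/= -val_eqE/= ltn_eqF.
Qed.

(** * Symmetry of second derivatives *)

Lemma is_derive_line (R : realType) (V W : normedModType R) (f : V -> W)
    (z e : V) (r : R) df :
  is_derive (z + r *: e) e f df -> is_derive r 1 (fun s => f (z + s *: e)) df.
Proof.
have e1 : (fun h => h^-1 *: (((fun s => f (z + s *: e)) \o shift r)
      (h *: 1) - f (z + r *: e))) =
    (fun h => h^-1 *: ((f \o shift (z + r *: e)) (h *: e) - f (z + r *: e))).
  apply/funext => h /=; congr (_ *: (f _ - _)).
  by rewrite scalerDl [h *: 1]mulr1 addrCA.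
by move=> [H1 H2]; apply: DeriveDef; [rewrite /derivable e1 | rewrite /derive e1].
Qed.

(** The mean value theorem is applied twice: first along [e] to the difference of [h] on two
    parallel sides, then along [e'] to [h1]. *)
Lemma second_difference (R : realType) (V : normedModType R)
    (h h1 h12 : V -> R) (x e e' : V) (s : R) : 0 < s ->
  (forall r r', 0 <= r <= s -> 0 <= r' <= s ->
    is_derive (x + r *: e + r' *: e') e h (h1 (x + r *: e + r' *: e')) /\
    is_derive (x + r *: e + r' *: e') e' h1 (h12 (x + r *: e + r' *: e'))) ->
  exists2 p : R * R, (0 <= p.1 <= s) && (0 <= p.2 <= s) &
    h (x + s *: e + s *: e') - h (x + s *: e) - (h (x + s *: e') - h x) =
    h12 (x + p.1 *: e + p.2 *: e') * s * s.
Proof.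
move=> s0 H; have ss : 0 <= s <= s by rewrite lexx ltW.
have z0 : 0 <= (0 : R) <= s by rewrite lexx ltW.
have dg r : 0 <= r <= s -> is_derive r 1
    (fun t => h (x + s *: e' + t *: e) - h (x + t *: e))
    (h1 (x + s *: e' + r *: e) - h1 (x + r *: e)).
  move=> rs; have [d1 _] := H _ _ rs ss; have [d2 _] := H _ _ rs z0.
  rewrite addrAC in d1; rewrite scale0r addr0 in d2.
  have l1 := is_derive_line d1; have l2 := is_derive_line d2.
  exact: is_deriveB.
have [||c cs] := MVT s0 (df := fun r => h1 (x + s *: e' + r *: e)
   - h1 (x + r *: e)) (f := fun t => h (x + s *: e' + t *: e) - h (x + t *: e)).
- by move=> r; rewrite in_itv/= => /andP[r0 rs]; apply: dg; rewrite !ltW.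
- apply: derivable_within_continuous => r; rewrite in_itv/= => rs.
  by case: (dg r rs).
rewrite scale0r !addr0 subr0 => Ec.
have {}cs : 0 <= c <= s by move: cs; rewrite in_itv/= => /andP[? ?]; rewrite !ltW.
have dk r : 0 <= r <= s -> is_derive r 1
    (fun t => h1 (x + c *: e + t *: e')) (h12 (x + c *: e + r *: e')).
  by move=> rs; have [_ d1] := H _ _ cs rs; exact: is_derive_line.
have [||c' cs'] := MVT s0 (df := fun r => h12 (x + c *: e + r *: e'))
  (f := fun t => h1 (x + c *: e + t *: e')).
- by move=> r; rewrite in_itv/= => /andP[r0 rs]; apply: dk; rewrite !ltW.
- apply: derivable_within_continuous => r; rewrite in_itv/= => rs.
  by case: (dk r rs).
rewrite scale0r !addr0 subr0 => Ec'.
exists (c, c') => /=.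
  by rewrite cs/=; move: cs'; rewrite in_itv/= => /andP[? ?]; rewrite !ltW.
by rewrite -Ec' [x + c *: e + _]addrAC -Ec [x + s *: e + _]addrAC.
Qed.

(** The second difference over a small parallelogram is symmetric in [e] and [e'], so [h12] and
    [h21] take a common value at two points arbitrarily close to [x]; continuity at [x]
    concludes. *)
Lemma is_derive_comm (R : realType) (V : normedModType R)
    (h h1 h2 h12 h21 : V -> R) (x e e' : V) :
  (\forall y \near x, is_derive y e h (h1 y)) ->
  (\forall y \near x, is_derive y e' h1 (h12 y)) ->
  (\forall y \near x, is_derive y e' h (h2 y)) ->
  (\forall y \near x, is_derive y e h2 (h21 y)) ->
  {for x, continuous h12} -> {for x, continuous h21} -> h12 x = h21 x.
Proof.
move=> n1 n12 n2 n21 /cvgrPdist_le c1 /cvgrPdist_le c2.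
apply/eqP; rewrite -subr_eq0 -normr_le0; apply/ler_addgt0Pr => eps eps0.
rewrite add0r.
have eps2 : 0 < eps / 2 by rewrite divr_gt0.
have : \forall y \near x, [/\ is_derive y e h (h1 y) /\ is_derive y e' h1 (h12 y),
    is_derive y e' h (h2 y) /\ is_derive y e h2 (h21 y),
    `|h12 x - h12 y| <= eps / 2 & `|h21 x - h21 y| <= eps / 2].
  near=> y; split; [split | split | |].
  - by near: y; exact: n1.
  - by near: y; exact: n12.
  - by near: y; exact: n2.
  - by near: y; exact: n21.
  - by near: y; exact: c1.
  - by near: y; exact: c2.
move=> /nbhs_ballP[d /= dgt0 Hd].
(* The summand 1 keeps [k] positive when both directions vanish, and makes every point of the
   parallelogram of side parameter [d / k] lie strictly within distance [d] of [x]. *)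
pose k := `|e| + `|e'| + 1; have k0 : 0 < k by rewrite ltr_wpDl ?addr_ge0.
pose s := d / k; have s0 : 0 < s by rewrite !divr_gt0.
have near_pt r r' : 0 <= r <= s -> 0 <= r' <= s -> ball x d (x + r *: e + r' *: e').
  move=> /andP[r0 rs] /andP[r'0 r's]; rewrite -ball_normE/= -addrA opprD addNKr.
  rewrite normrN (le_lt_trans (ler_normD _ _))// !normrZ !ger0_norm//.
  have -> : d = s * `|e| + s * `|e'| + s.
    by rewrite -mulrDr -[X in _ + X]mulr1 -mulrDr divfK// gt_eqF.
  by rewrite ltr_pwDr// lerD// ler_wpM2r.
have [r r' hr hr'|[a a'] /andP[/= ha ha'] Ea] :=
    @second_difference _ _ h h1 h12 x e e' s s0.
  by have [] := Hd _ (near_pt _ _ hr hr').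
have [r r' hr hr'|[b b'] /andP[/= hb hb'] Eb] :=
    @second_difference _ _ h h2 h21 x e' e s s0.
  by rewrite addrAC; have [] := Hd _ (near_pt _ _ hr' hr).
have [_ _ H1 _] := Hd _ (near_pt _ _ ha ha').
have [_ _ _ H2] := Hd _ (near_pt _ _ hb' hb).
(* Both sides times [s * s] are the same alternating sum of the four corner values of [h]. *)
have E : h12 (x + a *: e + a' *: e') = h21 (x + b' *: e + b *: e').
  have ss0 : s * s != 0 by rewrite mulf_neq0 ?gt_eqF.
  apply: (mulIf ss0); rewrite [LHS]mulrA [RHS]mulrA.
  rewrite [x + b' *: e + _]addrAC; apply: etrans (esym Ea) _; apply: etrans _ Eb.
  rewrite [x + s *: e' + _]addrAC !opprB.
  by rewrite [LHS]addrAC -[RHS]addrA [RHS]addrA; ring.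
rewrite -E in H2; rewrite distrC in H2.
rewrite -(subrKA (h12 (x + a *: e + a' *: e'))).
by rewrite (splitr eps) (le_trans (ler_normD _ _))// lerD.
Unshelve. all: by end_near. Qed.

Lemma smooth_on_differentiable (R : realType) k (V : normedModType R)
    (D : set 'rV[R]_k.+1) (f : 'rV[R]_k.+1 -> V) x :
  smooth_on D f -> D x -> differentiable f x.
Proof. by move=> H Dx; have [dH _] := H 1%N; exact: dH. Qed.

Lemma smooth_on_partial (R : realType) k (V : normedModType R)
    (D : set 'rV[R]_k.+1) (f : 'rV[R]_k.+1 -> V) i :
  smooth_on D f -> smooth_on D (fun x => partial f x i).
Proof. by move=> H r; have [_ dH] := H r.+1; exact: dH. Qed.

Lemma smooth_on_is_derive (R : realType) k (V : normedModType R)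
    (D : set 'rV[R]_k.+1) (f : 'rV[R]_k.+1 -> V) x i :
  smooth_on D f -> D x -> is_derive x (delta_mx 0 i) f (partial f x i).
Proof.
by move=> H Dx; apply/derivableP/diff_derivable/(smooth_on_differentiable H Dx).
Qed.

Lemma partial_comm (R : realType) k (D : set 'rV[R]_k.+1)
    (h : 'rV[R]_k.+1 -> R) x i j :
  open D -> smooth_on D h -> D x ->
  partial (fun y => partial h y i) x j = partial (fun y => partial h y j) x i.
Proof.
move=> oD sh Dx; have nD : \forall y \near x, D y by exact: open_nbhs_nbhs.
have [si sj] := (smooth_on_partial i sh, smooth_on_partial j sh).
apply: (@is_derive_comm _ _ h (fun y => partial h y i) (fun y => partial h y j)
  (fun x => partial (fun y => partial h y i) x j)
  (fun x => partial (fun y => partial h y j) x i) x (delta_mx 0 i) (delta_mx 0 j)).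
1-4: by apply: filterS nD => y Dy; exact: smooth_on_is_derive Dy.
- exact: (smooth_on_partial j si 0%N).
- exact: (smooth_on_partial i sj 0%N).
Qed.

Lemma partial_comm_row (R : realType) k m (D : set 'rV[R]_k.+1)
    (h : 'rV[R]_k.+1 -> 'rV[R]_m) x i j :
  open D -> smooth_on D h -> D x ->
  partial (fun y => partial h y i) x j = partial (fun y => partial h y j) x i.
Proof.
move=> oD sh Dx; have nD : \forall y \near x, D y by exact: open_nbhs_nbhs.
have [si sj] := (smooth_on_partial i sh, smooth_on_partial j sh).
apply/rowP => a.
apply: (@is_derive_comm _ _ (fun y => h y 0 a)
  (fun y => partial h y i 0 a) (fun y => partial h y j 0 a)
  (fun x => partial (fun y => partial h y i) x j 0 a)
  (fun x => partial (fun y => partial h y j) x i 0 a) x (delta_mx 0 i) (delta_mx 0 j)).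
1-4: apply: filterS nD => y Dy; apply: is_derive_mxE; exact: smooth_on_is_derive Dy.
- apply: (@continuous_comp _ _ _ _ (fun M : 'rV[R]_m => M 0 a)).
    exact: (smooth_on_partial j si 0%N).
  exact: coord_continuous.
- apply: (@continuous_comp _ _ _ _ (fun M : 'rV[R]_m => M 0 a)).
    exact: (smooth_on_partial i sj 0%N).
  exact: coord_continuous.
Qed.

(** * Linear algebra of Lagrangian planes *)

Lemma dotE (R : realType) n (a b : 'rV[R]_n) : dot a b = (a *m b^T) 0 0.
Proof. by rewrite mxE; apply: eq_bigr => i _; rewrite mxE. Qed.

Lemma dotC (R : realType) n (a b : 'rV[R]_n) : dot a b = dot b a.
Proof. by apply: eq_bigr => i _; rewrite mulrC. Qed.

Lemma dotDl (R : realType) n (a b c : 'rV[R]_n) :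
  dot (a + b) c = dot a c + dot b c.
Proof. by rewrite !dotE mulmxDl mxE. Qed.

Lemma dotZl (R : realType) n k (a c : 'rV[R]_n) : dot (k *: a) c = k * dot a c.
Proof. by rewrite !dotE -scalemxAl mxE. Qed.

Lemma dotNl (R : realType) n (a c : 'rV[R]_n) : dot (- a) c = - dot a c.
Proof. by rewrite -scaleN1r dotZl mulN1r. Qed.

Lemma dotDr (R : realType) n (a b c : 'rV[R]_n) :
  dot c (a + b) = dot c a + dot c b.
Proof. by rewrite !(dotC c) dotDl. Qed.

Lemma dotZr (R : realType) n k (a c : 'rV[R]_n) : dot c (k *: a) = k * dot c a.
Proof. by rewrite !(dotC c) dotZl. Qed.

Lemma dotNr (R : realType) n (a c : 'rV[R]_n) : dot c (- a) = - dot c a.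
Proof. by rewrite !(dotC c) dotNl. Qed.

Lemma dot_sumZr (R : realType) n k (c : 'rV[R]_n) (a : 'I_k -> R) v :
  dot c (\sum_i a i *: v i) = \sum_i a i * dot c (v i).
Proof.
rewrite dotE linear_sum mulmx_sumr summxE; apply: eq_bigr => i _.
by rewrite -dotE dotZr.
Qed.

Lemma dot_gt0 (R : realType) n (a : 'rV[R]_n) : a != 0 -> 0 < dot a a.
Proof.
move=> a0; rewrite lt_def sumr_ge0 ?andbT => [|i _]; last by rewrite -expr2 sqr_ge0.
apply: contra a0; rewrite psumr_eq0 => [/allP a0|i _]; last by rewrite -expr2 sqr_ge0.
apply/eqP/rowP => i; rewrite mxE; apply/eqP.
by have := a0 i (mem_index_enum _); rewrite /= mulf_eq0 orbb.
Qed.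

(** If [v] kills the Gram matrix, then [v *m M] has squared length zero, hence vanishes. *)
Lemma row_free_gram (R : realType) k n (M : 'M[R]_(k, n)) :
  row_free M = (M *m M^T \in unitmx).
Proof.
apply/idP/idP => [fM|]; last first.
  rewrite -row_free_unit -!row_leq_rank => /leq_trans; apply.
  exact: mxrankM_maxl.
rewrite -row_free_unit; apply: inj_row_free => v vMM.
have : v *m M = 0.
  apply/eqP; apply: contraT => /dot_gt0.
  by rewrite dotE trmx_mul mulmxA -(mulmxA v) vMM mul0mx mxE ltxx.
by move=> vM; apply: (row_free_inj fM); rewrite vM mul0mx.
Qed.

Lemma exists_normal_frame (R : realType) k n (M : 'M[R]_(k, k + n)) :
  row_free M -> exists N : 'M[R]_(n, k + n), row_free N /\ N *m M^T = 0.
Proof.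
move=> fM; have e : \rank (kermx M^T) = n.
  by rewrite mxrank_ker mxrank_tr (eqP fM) addKn.
(* The frame is built with [\rank (kermx M^T)] rows, so that the rank equation can then be rewritten
   inside its type. *)
have : exists N : 'M[R]_(\rank (kermx M^T), k + n), row_free N /\ N *m M^T = 0.
  exists (row_base (kermx M^T)); split; first exact: row_base_free.
  by apply/eqP; rewrite -sub_kermx eq_row_base.
by rewrite e.
Qed.

Definition cplx (R : realType) m n (X Y : 'M[R]_(m, n)) : 'M[R[i]]_(m, n) :=
  map_mx (real_complex R) X + 'i%C *: map_mx (real_complex R) Y.

Lemma cplxE (R : realType) m n (X Y : 'M[R]_(m, n)) i j :
  cplx X Y i j = Complex (X i j) (Y i j).
Proof. by rewrite !mxE; simpc. Qed.

(* Multiply X + iY by the invertible real matrix whose columns are the rows of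
   M and a basis of their orthogonal complement: the columns of the second kind
   become purely imaginary. *)
Lemma det_cplx_frame (R : realType) k n (M : 'M[R]_(k, k + n))
    (X Y : 'M[R]_(k + n)) (A : 'M[R]_(k + n, k)) (P S : 'M[R]_k) :
  row_free M -> X *m M^T = A *m P -> Y *m M^T = A *m S ->
  (forall nu : 'rV[R]_(k + n), nu *m M^T = 0 -> X *m nu^T = 0) ->
  exists r : R, \det (cplx X Y) = (r%:C * \det (cplx P S) * 'i ^+ n)%C.
Proof.
move=> fM XM YM XN; have [N [fN NM]] := exists_normal_frame fM.
pose Q := col_mx M N.
have uQ : \det Q != 0.
  have : \det (Q *m Q^T) != 0.
    rewrite tr_col_mx mul_col_row NM -[M *m N^T]trmxK trmx_mul trmxK NM trmx0.
    by rewrite det_ublock mulf_neq0// -unitfE -unitmxE -row_free_gram.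
  by rewrite det_mulmx mulf_eq0 negb_or => /andP[].
have XNt : X *m N^T = 0.
  apply/matrixP => i j; have /XN : row j N *m M^T = 0 by rewrite -row_mul NM row0.
  move/matrixP/(_ i 0); rewrite [RHS]mxE => H; rewrite [RHS]mxE -[RHS]H !mxE.
  by apply: eq_bigr => l _; rewrite !mxE.
pose c m p (B : 'M[R]_(m, p)) := map_mx (real_complex R) B.
(* The columns along [M] are [A *m (P + iS)], and those along [N] are [i] times [Y *m N^T]; the left
   factor pulled out is therefore real, and [r] is its determinant divided by that of [Q]. *)
have E : cplx X Y *m c _ _ Q^T = c _ _ (row_mx A (Y *m N^T)) *m
    block_mx (cplx P S) 0 0 ('i%C)%:M.
  rewrite /c tr_col_mx !map_row_mx mul_mx_row mul_row_block !mulmx0 addr0 add0r.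
  rewrite !mulmxDl -!scalemxAl -!map_mxM XM YM XNt !map_mxM map_mx0 add0r.
  by rewrite mulmxDr -scalemxAr mul_mx_scalar.
have := congr1 determinant E.
rewrite !det_mulmx det_ublock det_scalar !det_map_mx det_tr => H.
exists (\det (row_mx A (Y *m N^T)) / \det Q).
rewrite rmorphM/= fmorphV/= -!mulrA mulrCA -H.
by rewrite [RHS]mulrC mulfK// fmorph_eq0.
Qed.

(** * Two-by-two matrices, phases and the Hodge star *)

Lemma sum_ord2 (V : nmodType) (F : 'I_2 -> V) :
  \sum_i F i = F ord0 + F ord_max.
Proof. by rewrite big_ord_recl big_ord1; congr (_ + F _); apply/val_inj. Qed.

Lemma ord2P (i : 'I_2) : {i = ord0} + {i = ord_max}.
Proof. by case: i => -[|[|//]] h; [left|right]; apply/val_inj. Qed.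

Lemma height_delta_lshift (R : realType) (i : 'I_2) :
  height (delta_mx 0 (lshift 1 i) : 'rV[R]_3) = 0.
Proof. by rewrite /height mxE; case: (ord2P i) => ->. Qed.

Lemma height_delta_max (R : realType) : height (delta_mx 0 ord_max : 'rV[R]_3) = 1.
Proof. by rewrite /height mxE eqxx. Qed.

Lemma det_mx2 (R : comPzRingType) (A : 'M[R]_2) :
  \det A = A ord0 ord0 * A ord_max ord_max - A ord0 ord_max * A ord_max ord0.
Proof.
rewrite (expand_det_row _ ord0) sum_ord2 /cofactor !det_mx11 !mxE/=.
rewrite (_ : lift _ _ = ord_max); last exact/val_inj.
rewrite (_ : lift _ _ = ord0); last exact/val_inj.
by rewrite expr0 expr1 mul1r mulN1r mulrN.
Qed.

(** The matrix on the right is the adjugate: [rev_ord] exchanges the two indices, hence the two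
    diagonal entries. *)
Lemma invmx2 (R : fieldType) (A : 'M[R]_2) : \det A != 0 ->
  invmx A = (\det A)^-1 *:
    \matrix_(i, j) (if i == j then A (rev_ord i) (rev_ord j) else - A i j).
Proof.
move=> dA; set B := _ *: _.
suff AB : A *m B = 1%:M.
  have uA : A \in unitmx by rewrite unitmxE unitfE.
  by rewrite -[B](mulKmx uA) AB mulmx1.
have [r0 r1] : rev_ord (ord0 : 'I_2) = ord_max /\ rev_ord (ord_max : 'I_2) = ord0.
  by split; apply/val_inj.
move: dA; rewrite /B det_mx2 => dA.
apply/matrixP => i j; rewrite !mxE sum_ord2 !mxE.
by case: (ord2P i) => ->; case: (ord2P j) => ->;
  rewrite /= ?r0 ?r1 ?eqxx /=; field.
Qed.

(** Each factor [i] adds [pi / 2] to the angle. In the induction the angle of the hypothesis moves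
    by [pi], which only changes the sign of the sine. *)
Lemma Im_expi_mul_i_exp (R : realType) (theta : R) n :
  sin (theta - n%:R * (pi / 2)) = 0 ->
  complex.Im (expi theta * 'i%C ^+ n) = 0.
Proof.
elim: n theta => [|n IH] theta; first by rewrite mul0r subr0 mulr1.
move=> H; rewrite exprS mulrA.
have -> : expi theta * 'i%C = expi (theta + pi / 2).
  by rewrite /expi; simpc; rewrite cosD sinD cos_pihalf sin_pihalf; congr Complex; ring.
apply: IH; rewrite (_ : _ - _ = theta - n.+1%:R * (pi / 2) + pi).
  by rewrite sinDpi H oppr0.
by rewrite -natr1; field.
Qed.

(** The matrix of the Hodge star acting on the column of components of a 1-form; the transpose is
    there because [hodge] contracts the form with the first index of the product. *)
Definition hodge_mx (R : realType) (g : 'M[R]_2) : 'M[R]_2 :=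
  Num.sqrt (\det g) *: (invmx g *m levi_civita R)^T.

Lemma hodge_mxE (R : realType) (g : 'M[R]_2) (W := Num.sqrt (\det g)) :
  g^T = g -> 0 < \det g ->
  [/\ hodge_mx g ord0 ord0 = g ord0 ord_max / W,
      hodge_mx g ord0 ord_max = - g ord0 ord0 / W,
      hodge_mx g ord_max ord0 = g ord_max ord_max / W
    & hodge_mx g ord_max ord_max = - g ord0 ord_max / W].
Proof.
move=> gT dg.
have g10 : g ord_max ord0 = g ord0 ord_max by rewrite -[in LHS]gT mxE.
have W0 : W != 0 by rewrite gt_eqF// sqrtr_gt0.
have dW : \det g = W ^+ 2 by rewrite sqr_sqrtr// ltW.
rewrite /hodge_mx invmx2 ?gt_eqF// -/W dW.
have [r0 r1] : rev_ord (ord0 : 'I_2) = ord_max /\ rev_ord (ord_max : 'I_2) = ord0.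
  by split; apply/val_inj.
by split; rewrite !mxE sum_ord2 !mxE/= ?r0 ?r1 ?g10 /=; field.
Qed.

Section lagrangian_block.
Variables (R : realType) (g : 'M[R]_2) (S : 'M[R]_2) (t f : R).
Hypotheses (gT : g^T = g) (dg : 0 < \det g).
Let L := t%:M - f *: hodge_mx g.

(** The Hodge matrix has trace 0 and determinant 1, so it behaves like a square root of -1 and the
    determinant is the squared modulus of [t - i f]. *)
Lemma det_scalar_sub_hodge_mx : \det L = t ^+ 2 + f ^+ 2.
Proof.
have [h00 h01 h10 h11] := hodge_mxE gT dg.
have W0 : Num.sqrt (\det g) != 0 by rewrite gt_eqF// sqrtr_gt0.
have dW : Num.sqrt (\det g) ^+ 2 = \det g by rewrite sqr_sqrtr// ltW.
have g10 : g ord_max ord0 = g ord0 ord_max by rewrite -[in LHS]gT mxE.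
rewrite /L; move: (hodge_mx g) (Num.sqrt (\det g)) h00 h01 h10 h11 W0 dW.
move=> J W h00 h01 h10 h11 W0; rewrite !det_mx2 g10 !mxE h00 h01 h10 h11/= => dW.
transitivity (t ^+ 2 + f ^+ 2 * (g ord0 ord0 * g ord_max ord_max
    - g ord0 ord_max * g ord0 ord_max) / W ^+ 2); first by field.
by rewrite -dW; field.
Qed.

Hypotheses (ST : S^T = S)
  (trS : g ord_max ord_max * S ord0 ord0 + g ord0 ord0 * S ord_max ord_max
         - 2 * g ord0 ord_max * S ord0 ord_max = 0).

(** The hypothesis [trS] is the vanishing of the trace of [S] for the metric [g], multiplied by
    [\det g]. The skew part of [L *m S] is a multiple of this trace, with factor [- f / W]. *)
Lemma scalar_sub_hodge_mx_sym : (L *m S)^T = L *m S.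
Proof.
have [h00 h01 h10 h11] := hodge_mxE gT dg.
have W0 : Num.sqrt (\det g) != 0 by rewrite gt_eqF// sqrtr_gt0.
have s10 : S ord_max ord0 = S ord0 ord_max by rewrite -[in LHS]ST mxE.
have key : (L *m S) ord_max ord0 = (L *m S) ord0 ord_max.
  rewrite /L; move: (hodge_mx g) h00 h01 h10 h11 => J h00 h01 h10 h11.
  rewrite !mxE !sum_ord2 !mxE h00 h01 h10 h11 s10/=.
  move: (Num.sqrt (\det g)) W0 => W W0.
  apply/eqP; rewrite -subr_eq0 -(mulr0 (- f / W)) -trS; apply/eqP; by field.
by apply/matrixP => i j; rewrite [LHS]mxE; case: (ord2P i) => ->; case: (ord2P j) => ->.
Qed.

(** The product of the Hodge matrix with [g] is skew, so it does not pair with the symmetric [S];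
    the imaginary part that remains is [t] times the expression in [trS]. *)
Lemma Im_det_cplx : complex.Im (\det (cplx (L *m g) S)) = 0.
Proof.
have [h00 h01 h10 h11] := hodge_mxE gT dg.
have W0 : Num.sqrt (\det g) != 0 by rewrite gt_eqF// sqrtr_gt0.
have s10 : S ord_max ord0 = S ord0 ord_max by rewrite -[in LHS]ST mxE.
have g10 : g ord_max ord0 = g ord0 ord_max by rewrite -[in LHS]gT mxE.
rewrite /L; move: (hodge_mx g) h00 h01 h10 h11 => J h00 h01 h10 h11.
rewrite det_mx2 !cplxE; simpc => /=; rewrite !mxE !sum_ord2 !mxE h00 h01 h10 h11 s10 g10/=.
move: (Num.sqrt (\det g)) W0 => W W0.
by rewrite -(mulr0 t) -trS; field.
Qed.

End lagrangian_block.

(** * From the two-by-two block to the whole tangent plane *)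

Lemma cplx_block_mx (R : realType) m1 m2 n1 n2 (A A' : 'M[R]_(m1, n1))
    (B B' : 'M[R]_(m1, n2)) (C C' : 'M[R]_(m2, n1)) (D D' : 'M[R]_(m2, n2)) :
  cplx (block_mx A B C D) (block_mx A' B' C' D') =
  block_mx (cplx A A') (cplx B B') (cplx C C') (cplx D D').
Proof.
apply/matrixP => i j; rewrite cplxE !mxE.
by case: fintype.split => a; rewrite !mxE; case: fintype.split => b; rewrite !mxE; simpc.
Qed.

Lemma cplx0 (R : realType) m n : cplx (0 : 'M[R]_(m, n)) 0 = 0.
Proof. by apply/matrixP => i j; rewrite cplxE !mxE. Qed.

Lemma gramE (R : realType) k n (M : 'M[R]_(k, n)) i j :
  (M *m M^T) i j = dot (row i M) (row j M).
Proof. by rewrite !mxE; apply: eq_bigr => l _; rewrite !mxE. Qed.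

(** Strict Cauchy-Schwarz: the vector [dot a a *: b - dot a b *: a] has squared length [dot a a]
    times the determinant, so a nonpositive determinant would give a linear relation between the two
    rows. *)
Lemma det_gram2_gt0 (R : realType) n (M : 'M[R]_(2, n)) :
  row_free M -> 0 < \det (M *m M^T).
Proof.
move=> fM; rewrite ltNge det_mx2 !gramE; apply/negP.
rewrite (dotC (row ord_max M) (row ord0 M)).
set a := row ord0 M; set b := row ord_max M => dneg.
have a0 : a != 0.
  apply/eqP => a0; have /row_freeP[B MB] := fM.
  have : row ord0 (M *m B) ord0 ord0 = 0 by rewrite row_mul -/a a0 mul0mx mxE.
  by rewrite MB !mxE eqxx => /eqP; rewrite oner_eq0.
have aa := dot_gt0 a0.
have w0 : dot a a *: b - dot a b *: a = 0.
  apply/eqP; apply: contraT => /dot_gt0.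
  rewrite !(dotDl, dotDr, dotNl, dotNr, dotZl, dotZr) (dotC b a) ltNge => /negP[].
  rewrite (_ : _ + _ = dot a a * (dot a a * dot b b - dot a b * dot a b)); last by ring.
  by rewrite pmulr_rle0.
pose v : 'rV[R]_2 := \row_i (if i == ord0 then - dot a b else dot a a).
have vM : v *m M = 0 *m M.
  rewrite mul0mx mulmx_sum_row sum_ord2 !mxE/= -/a -/b scaleNr addrC.
  exact: w0.
have /rowP/(_ ord_max) := row_free_inj fM vM.
by rewrite !mxE/= => aa0; rewrite aa0 ltxx in aa.
Qed.

(** This isolates the linear algebra. The [dx] parts lie in the span of [U] and the rows of [M], so
    the form [omega] sees only the matrix [L *m S], and [det_cplx_frame] reduces [dz] to the
    determinant of [L *m g + iS] times a real number and a power of [i]. *)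
Lemma special_lagrangian_plane_of_block (R : realType) n (theta : R)
    (U : 'rV[R]_n.+1) (M : 'M[R]_(2, n.+1)) (S : 'M[R]_2) (t f : R)
    (T : set ('rV[R]_n.+1 * 'rV[R]_n.+1)) (g := M *m M^T) :
  dot U U = 1 -> M *m U^T = 0 -> row_free M -> S^T = S ->
  g ord_max ord_max * S ord0 ord0 + g ord0 ord0 * S ord_max ord_max
    - 2 * g ord0 ord_max * S ord0 ord_max = 0 ->
  (forall v, T v -> exists p (A : 'rV[R]_2),
    [/\ v.1 = p *: U + A *m ((t%:M - f *: hodge_mx g) *m M),
        v.2 *m U^T = 0 & v.2 *m M^T = A *m S]) ->
  sin (cophase n theta) = 0 ->
  special_lagrangian_plane theta T.
Proof.
move=> U1 MU fM ST trS HT sphi.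
have dg : 0 < \det g := det_gram2_gt0 fM.
have gT : g^T = g by rewrite /g trmx_mul trmxK.
have := (scalar_sub_hodge_mx_sym t f gT dg ST trS, Im_det_cplx t f gT dg ST trS).
move: HT; move: (t%:M - _) => L HT [symL ImL].
have UM : U *m M^T = 0 by rewrite -[M^T]trmxK trmxK -[U]trmxK -trmx_mul MU trmx0.
have tr00 (Z : 'M[R]_1) : Z 0 0 = Z^T 0 0 by rewrite mxE.
split.
  move=> v v' /HT[p [A [vx vU vM]]] /HT[p' [A' [vx' vU' vM']]].
  (* As [a] lies in the span of [U] and the rows of [M], the pairing depends only on the products of
     [c] with these vectors, which are known. *)
  have pair (a c : 'rV[R]_n.+1) q B C : a = q *: U + B *m (L *m M) ->
      c *m U^T = 0 -> c *m M^T = C *m S -> dot a c = (B *m (L *m S) *m C^T) 0 0.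
    move=> -> cU cM; rewrite dotC dotE linearD/= linearZ/= mulmxDr -scalemxAr cU.
    rewrite scaler0 add0r !trmx_mul !mulmxA cM [RHS]tr00.
    by rewrite !trmx_mul trmxK ST !mulmxA.
  rewrite /omega (pair _ _ _ _ _ vx vU' vM') (dotC v.2) (pair _ _ _ _ _ vx' vU vM).
  rewrite [X in _ - X]tr00 trmx_mul trmxK [in X in _ - X]trmx_mul.
  by rewrite symL -!mulmxA subrr.
move=> v Tv; pose M3 : 'M[R]_(1 + 2, n.+1) := col_mx U M.
have fM3 : row_free M3.
  rewrite row_free_gram tr_col_mx mul_col_row MU UM unitmxE det_ublock unitfE.
  by rewrite det_mx11 -dotE U1 mul1r gt_eqF.
have [p Hp] := choice (fun a => HT _ (Tv a)).
have [A HA] := choice Hp.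
pose X := \matrix_a (v a).1; pose Y := \matrix_a (v a).2.
pose C : 'M[R]_(n.+1, 1 + 2) := row_mx (\col_a p a) (\matrix_a A a).
have XM : X *m M3^T = C *m block_mx 1%:M 0 0 (L *m g).
  apply/row_matrixP => a; rewrite !row_mul !rowK row_row_mx rowK tr_col_mx.
  have [-> _ _] := HA a.
  rewrite mul_mx_row mul_row_block !mulmx0 addr0 add0r mulmx1.
  rewrite !mulmxDl -!scalemxAl -!mulmxA MU UM scaler0 !mulmx0 addr0 add0r.
  by congr row_mx; apply/rowP => i; rewrite ord1 mxE -dotE U1 mulr1 !mxE.
have YM : Y *m M3^T = C *m block_mx 0 0 0 S.
  apply/row_matrixP => a; rewrite !row_mul !rowK row_row_mx rowK tr_col_mx.
  have [_ vU vM] := HA a.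
  by rewrite mul_mx_row mul_row_block !mulmx0 addr0 add0r vU vM.
have XN (nu : 'rV[R]_n.+1) : nu *m M3^T = 0 -> X *m nu^T = 0.
  rewrite tr_col_mx mul_mx_row -[0 in RHS]row_mx0 => /eq_row_mx[nU nM].
  apply/row_matrixP => a; rewrite row_mul rowK row0.
  have [-> _ _] := HA a; rewrite mulmxDl -scalemxAl -!mulmxA.
  have -> : U *m nu^T = 0 by rewrite -[LHS]trmxK trmx_mul trmxK nU trmx0.
  have -> : M *m nu^T = 0 by rewrite -[LHS]trmxK trmx_mul trmxK nM trmx0.
  by rewrite !mulmx0 scaler0 addr0.
have -> : dz v = \det (cplx X Y).
  by congr (\det _); apply/matrixP => a j; rewrite cplxE !mxE.
(* Three independent rows force [n] to be at least 2; writing [n] as [n'.+2] gives the matrices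
   [3 + n'] columns, the form that [det_cplx_frame] asks for. *)
have n2 : (2 <= n)%N by have := rank_leq_col M3; rewrite (eqP fM3).
clearbody C X Y.
case: n n2 U M @g M3 X Y C fM3 XM YM XN symL ImL sphi
  {U1 MU fM trS T HT UM v Tv p Hp A HA dg gT} => [|[|n]]//.
move=> _ U M g M3 X Y C fM3 XM YM XN symL ImL sphi.
have [r ->] := @det_cplx_frame R (1 + 2) n M3 X Y C _ _ fM3 XM YM XN.
have -> : cplx (block_mx (1%:M : 'M[R]_1) 0 0 (L *m g)) (block_mx 0 0 0 S) =
    block_mx 1%:M 0 0 (cplx (L *m g) S).
  rewrite cplx_block_mx !cplx0.
  by congr block_mx; apply/matrixP => i j; rewrite !ord1 cplxE !mxE.
rewrite det_ublock det1 mul1r.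
(* Here [n] is the former [n] minus 2, the number of normal directions, so the shift in [cophase] is
   exactly [n] quarter turns. *)
have {}sphi : complex.Im (expi theta * 'i%C ^+ n) = 0.
  apply: Im_expi_mul_i_exp; rewrite -sphi /cophase; congr (sin (_ - _ * _)).
  by rewrite -!natr1; ring.
rewrite (_ : _ * _ = r%:C%C * (expi theta * 'i%C ^+ n * \det (cplx (L *m g) S)));
  last by ring.
move: sphi ImL.
case: (expi theta * _) => a b /= ->; case: (\det _) => a' b' /= ->.
by simpc.
Qed.

(** * Geometry of a chart of the surface *)

Lemma near_cst_is_derive (R : realType) (V W : normedModType R) (f : V -> W)
    x v df :
  is_derive x v f df -> (\forall y \near x, f y = f x) -> df = 0.
Proof. by move=> [_ <-] /(near_eq_derive v (g := cst (f x))) ->; exact: derive_cst. Qed.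

Lemma differentiable_dot (R : realType) (V : normedModType R) n
    (f g : V -> 'rV[R]_n) x :
  differentiable f x -> differentiable g x ->
  differentiable (fun y => dot (f y) (g y)) x.
Proof.
move=> df dg.
have -> : (fun y => dot (f y) (g y)) =
    \sum_(i < n) ((fun y => f y 0 i) * (fun y => g y 0 i)).
  by apply/funext => y; rewrite fct_sumE.
apply: differentiable_sum => i; apply: differentiableM.
  apply: (@differentiable_comp _ _ _ _ f (fun M : 'rV[R]_n => M 0 i)) => //.
  exact: differentiable_coord.
apply: (@differentiable_comp _ _ _ _ g (fun M : 'rV[R]_n => M 0 i)) => //.
exact: differentiable_coord.
Qed.

Lemma is_derive_sqrtV (R : realType) (s : R) : 0 < s ->
  is_derive s 1 (fun x => (Num.sqrt x)^-1) (- (2 * s * Num.sqrt s)^-1).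
Proof.
move=> s0; have r0 : Num.sqrt s != 0 by rewrite gt_eqF// sqrtr_gt0.
have [d1 d2] := is_derive1_sqrt s0.
apply: DeriveDef; first exact: derivableV.
rewrite deriveV// d2 /GRing.scale/=; have := sqr_sqrtr (ltW s0).
by move: (Num.sqrt s) r0 => r r0 <-; field.
Qed.

Lemma dot_lincomb2 (R : realType) n (a b : R) (p q v : 'rV[R]_n) :
  dot (a *: p + b *: q) v = a * dot v p + b * dot v q.
Proof. by rewrite dotDl !dotZl !(dotC v). Qed.

(** The divergence of a flux with the square roots cleared: [r] stands for the area density and [w]
    for the determinant of the metric. *)
Lemma sqrt_flux_sum (F : realFieldType) (r w A K B A' K' B' : F) :
  r != 0 -> r ^+ 2 = w ->
  r^-1 * (A / r - K * B / (2 * w * r) + (A' / r - K' * B' / (2 * w * r))) =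
  (A + A') / w - (K * B + K' * B') / 2 / w ^+ 2.
Proof.
by move=> r0 <-; field.
Qed.

Section surface_patch.
Variables (R : realType) (S : oriented_surface R) (n : nat).
Variables (u : S -> 'rV[R]_n.+1) (c : chart R S).
Hypotheses (hu : minimal_immersion u) (hc : atlas c).

Let D := chart_img c.
Let d2 (V : normedModType R) (h : S -> V) (i j : 'I_2) (x : 'rV[R]_2) : V :=
  partial (fun y => ext_d h c y j) x i.

Definition differential_mx (x : 'rV[R]_2) : 'M[R]_(2, n.+1) :=
  \matrix_i ext_d u c x i.

Lemma near_chart_img x : D x -> \forall y \near x, D y.
Proof. by move=> Dx; apply: open_nbhs_nbhs; split => //; exact: chart_img_open. Qed.

Lemma smooth_is_derive (V : normedModType R) (h : S -> V) x i :
  smooth h -> D x -> is_derive x (delta_mx 0 i) (loc c h) (ext_d h c x i).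
Proof. by move=> hh Dx; exact: (smooth_on_is_derive i (hh c hc) Dx). Qed.

Lemma smooth_is_derive2 (V : normedModType R) (h : S -> V) x i j :
  smooth h -> D x ->
  is_derive x (delta_mx 0 i) (fun y => ext_d h c y j) (d2 h i j x).
Proof.
by move=> hh Dx; exact: (smooth_on_is_derive i (smooth_on_partial j (hh c hc)) Dx).
Qed.

Lemma smooth_differentiable_loc (V : normedModType R) (h : S -> V) x :
  smooth h -> D x -> differentiable (loc c h) x.
Proof. by move=> hh Dx; exact: (smooth_on_differentiable (hh c hc) Dx). Qed.

Lemma smooth_differentiable_ext_d (V : normedModType R) (h : S -> V) x i :
  smooth h -> D x -> differentiable (fun y => ext_d h c y i) x.
Proof.
by move=> hh Dx;
  exact: (smooth_on_differentiable (smooth_on_partial i (hh c hc)) Dx).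
Qed.

Let su : smooth u. Proof. by case: hu. Qed.

Lemma dot_loc x : dot (loc c u x) (loc c u x) = 1.
Proof. by case: hu => _ /(_ (chart_inv c x)). Qed.

(** The derivative of the constant [dot u u]. *)
Lemma dot_ext_d x i : D x -> dot (loc c u x) (ext_d u c x i) = 0.
Proof.
move=> Dx; have du := smooth_is_derive i su Dx.
have : dot (ext_d u c x i) (loc c u x) + dot (loc c u x) (ext_d u c x i) = 0.
  apply: near_cst_is_derive (is_derive_dot du du) _.
  by near=> y; rewrite !dot_loc.
by rewrite dotC -mulr2n => /eqP; rewrite mulrn_eq0 => /eqP.
Unshelve. all: by end_near. Qed.

(** The derivative of the identity [dot_ext_d], which holds near [x]: the part of the second
    derivatives along [u] is minus the metric. *)
Lemma dot_d2 x i j : D x ->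
  dot (loc c u x) (d2 u i j x) = - dot (ext_d u c x i) (ext_d u c x j).
Proof.
move=> Dx; have du := smooth_is_derive i su Dx.
have d2u := smooth_is_derive2 i j su Dx.
have : dot (ext_d u c x i) (ext_d u c x j) + dot (loc c u x) (d2 u i j x) = 0.
  apply: near_cst_is_derive (is_derive_dot du d2u) _.
  by apply: filterS (near_chart_img Dx) => y Dy; rewrite !dot_ext_d.
by rewrite addrC => /eqP; rewrite addr_eq0 => /eqP.
Qed.

Lemma differential_mx_free x : D x -> row_free (differential_mx x).
Proof. by case: hu => _ _ + _ => /(_ c hc x). Qed.

Lemma metricE x : metric u c x = differential_mx x *m (differential_mx x)^T.
Proof. by apply/matrixP => i j; rewrite gramE !rowK mxE. Qed.

Lemma induced_metric_sym x : (metric u c x)^T = metric u c x.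
Proof. by rewrite metricE trmx_mul trmxK. Qed.

Lemma det_metric_gt0 x : D x -> 0 < \det (metric u c x).
Proof. by move=> Dx; rewrite metricE; exact/det_gram2_gt0/differential_mx_free. Qed.

Lemma hodgeE (V : normedModType R) (alpha : form1 S V) x k :
  hodge u alpha c x k =
  \sum_i hodge_mx (metric u c x) k i *: alpha c x i.
Proof.
rewrite /hodge scaler_sumr; apply: eq_bigr => i _.
by rewrite !mxE mulr_sumr scaler_suml scaler_sumr; apply: eq_bigr => j _; rewrite scalerA.
Qed.

Lemma inv_metricE x (w := \det (metric u c x)) : D x ->
  [/\ inv_metric u c x ord0 ord0 = metric u c x ord_max ord_max / w,
      inv_metric u c x ord0 ord_max = - metric u c x ord0 ord_max / w,
      inv_metric u c x ord_max ord0 = - metric u c x ord0 ord_max / w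
    & inv_metric u c x ord_max ord_max = metric u c x ord0 ord0 / w].
Proof.
move=> Dx; rewrite /inv_metric invmx2 ?gt_eqF ?det_metric_gt0// -/w.
have [r0 r1] : rev_ord (ord0 : 'I_2) = ord_max /\ rev_ord (ord_max : 'I_2) = ord0.
  by split; apply/val_inj.
have g10 : metric u c x ord_max ord0 = metric u c x ord0 ord_max.
  by rewrite -[in LHS]induced_metric_sym mxE.
split; rewrite mxE [X in _ * X]mxE ?r0 ?r1 ?g10 ?eqxx/= 1?mulrC//.
Qed.

Let dg i j k x := dot (d2 u i j x) (ext_d u c x k) + dot (d2 u i k x) (ext_d u c x j).

Lemma is_derive_metric x i j k : D x ->
  is_derive x (delta_mx 0 i) (fun y => metric u c y j k) (dg i j k x).
Proof.
move=> Dx; have dj := smooth_is_derive2 i j su Dx.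
have dk := smooth_is_derive2 i k su Dx.
have -> : (fun y => metric u c y j k) =
    (fun y => dot (ext_d u c y j) (ext_d u c y k)).
  by apply/funext => y; rewrite mxE.
have H := is_derive_dot dj dk.
by rewrite /dg [X in _ + X]dotC; exact: H.
Qed.

Lemma d2_comm x i j : D x -> d2 u i j x = d2 u j i x.
Proof.
move=> Dx; apply: (@partial_comm_row _ _ _ D (loc c u)) => //.
  exact: chart_img_open.
exact: su.
Qed.

Lemma d2_comm_real (h : S -> R) x i j : smooth h -> D x -> d2 h i j x = d2 h j i x.
Proof.
move=> hh Dx; apply: (@partial_comm _ _ D (loc c h)) => //.
  exact: chart_img_open.
exact: hh.
Qed.

(** * The Laplacian in coordinates *)

Let g x i j := metric u c x i j.
Let w x := g x ord0 ord0 * g x ord_max ord_max - g x ord0 ord_max * g x ord0 ord_max.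

Lemma det_metricE x : \det (metric u c x) = w x.
Proof.
have g10 : metric u c x ord_max ord0 = metric u c x ord0 ord_max.
  by rewrite -[in LHS]induced_metric_sym mxE.
by rewrite det_mx2 g10.
Qed.

(** The inverse metric is the adjugate over the determinant, and the area density is the square root
    of that determinant, so a single inverse square root is left to differentiate. *)
Lemma vol_gradient h x : D x ->
  vol u c x * gradient u h c x ord0 =
    (g x ord_max ord_max * ext_d h c x ord0
     - g x ord0 ord_max * ext_d h c x ord_max) * (Num.sqrt (w x))^-1 /\
  vol u c x * gradient u h c x ord_max =
    (g x ord0 ord0 * ext_d h c x ord_max
     - g x ord0 ord_max * ext_d h c x ord0) * (Num.sqrt (w x))^-1.
Proof.
move=> Dx; have dpos := det_metric_gt0 Dx.
have [h00 h01 h10 h11] := inv_metricE Dx.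
rewrite /gradient !sum_ord2 h00 h01 h10 h11 /vol !det_metricE.
rewrite det_metricE in dpos.
have r0 : Num.sqrt (w x) != 0 by rewrite gt_eqF// sqrtr_gt0.
have := sqr_sqrtr (ltW dpos); rewrite /g.
move: (w x) (Num.sqrt (w x)) (metric u c x) (ext_d h c x) r0 => ? r G dh r0 <-.
by split; field.
Qed.

Let differentiable_g x j k : D x -> differentiable (fun y => g y j k) x.
Proof.
move=> Dx; have -> : (fun y => g y j k) =
    (fun y => dot (ext_d u c y j) (ext_d u c y k)).
  by apply/funext => y; rewrite /g mxE.
by apply: differentiable_dot; apply: smooth_differentiable_ext_d.
Qed.

Let dw i x := dg i ord0 ord0 x * g x ord_max ord_max
  + g x ord0 ord0 * dg i ord_max ord_max x - 2 * g x ord0 ord_max * dg i ord0 ord_max x.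

Lemma is_derive_sqrt_det_metricV x i : D x ->
  is_derive x (delta_mx 0 i) (fun y => (Num.sqrt (w y))^-1)
    (- (2 * w x * Num.sqrt (w x))^-1 * dw i x).
Proof.
move=> Dx.
have d00 := is_derive_metric i ord0 ord0 Dx.
have d01 := is_derive_metric i ord0 ord_max Dx.
have d11 := is_derive_metric i ord_max ord_max Dx.
have D00 := differentiable_g ord0 ord0 Dx.
have D01 := differentiable_g ord0 ord_max Dx.
have D11 := differentiable_g ord_max ord_max Dx.
have w0 : 0 < w x by rewrite -det_metricE det_metric_gt0.
have Dw : differentiable w x.
  by apply: (@differentiableB _ _ _ ((fun y => g y ord0 ord0) * (fun y => g y ord_max ord_max))
    ((fun y => g y ord0 ord_max) * (fun y => g y ord0 ord_max))); apply: differentiableM.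
have dw_ : is_derive x (delta_mx 0 i) w (dw i x).
  have H1 := is_deriveM d00 d11; have H2 := is_deriveM d01 d01.
  have H := is_deriveB H1 H2.
  apply: is_derive_eq H _.
  rewrite /dw /g /GRing.scale/=.
  move: (dg i ord0 ord0 x) (dg i ord0 ord_max x) (dg i ord_max ord_max x) (metric u c x).
  by move=> ? ? ? ?; ring.
have [_ <-] := dw_.
exact: (@is_derive_comp_real _ _ w (fun s => (Num.sqrt s)^-1) x (delta_mx 0 i) _ Dw
  (is_derive_sqrtV w0)).
Qed.

(** The indices are left free so that one computation serves both components of the flux. *)
Lemma is_derive_flux (h : S -> R) x i j1 k1 j2 k2 l1 l2 : smooth h -> D x ->
  is_derive x (delta_mx 0 i)
    (fun y => (g y j1 k1 * ext_d h c y l1 - g y j2 k2 * ext_d h c y l2)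
      * (Num.sqrt (w y))^-1)
    ((dg i j1 k1 x * ext_d h c x l1 + g x j1 k1 * d2 h i l1 x
      - (dg i j2 k2 x * ext_d h c x l2 + g x j2 k2 * d2 h i l2 x))
      * (Num.sqrt (w x))^-1
     - (g x j1 k1 * ext_d h c x l1 - g x j2 k2 * ext_d h c x l2)
       * dw i x / (2 * w x * Num.sqrt (w x))).
Proof.
move=> hh Dx.
have d1 := is_derive_metric i j1 k1 Dx.
have d2_ := is_derive_metric i j2 k2 Dx.
have h1 := smooth_is_derive2 i l1 hh Dx.
have h2 := smooth_is_derive2 i l2 hh Dx.
have H := is_deriveM (is_deriveB (is_deriveM d1 h1) (is_deriveM d2_ h2))
  (is_derive_sqrt_det_metricV i Dx).
apply: is_derive_eq H _.
rewrite /GRing.scale/= !fctE /g.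
move: (dg i j1 k1 x) (dg i j2 k2 x) (metric u c x) (d2 h i l1 x) (d2 h i l2 x)
  (ext_d h c x) (dw i x) (Num.sqrt _)^-1 (2 * _ * _)^-1.
by move=> *; ring.
Qed.

Definition gradient_vector (h : S -> R) (x : 'rV[R]_2) : 'rV[R]_n.+1 :=
  \sum_i gradient u h c x i *: ext_d u c x i.

Lemma dot_gradient_vector (h : S -> R) x v :
  dot (gradient_vector h x) v =
  gradient u h c x ord0 * dot v (ext_d u c x ord0) +
  gradient u h c x ord_max * dot v (ext_d u c x ord_max).
Proof. by rewrite /gradient_vector sum_ord2 dot_lincomb2. Qed.

(* Since d_i d_j u . d_l u are the Christoffel symbols of the first kind, the
   second term is the connection part of the covariant Hessian. *)
Lemma laplacianE (h : S -> R) x : smooth h -> D x ->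
  laplacian u h c x = \sum_i \sum_j inv_metric u c x i j *
    (d2 h i j x - dot (gradient_vector h x) (d2 u i j x)).
Proof.
move=> hh Dx; have w0 : 0 < w x by rewrite -det_metricE det_metric_gt0.
have r0 : Num.sqrt (w x) != 0 by rewrite gt_eqF// sqrtr_gt0.
have f0 := is_derive_flux ord0 ord_max ord_max ord0 ord_max ord0 ord_max hh Dx.
have f1 := is_derive_flux ord_max ord0 ord0 ord0 ord_max ord_max ord0 hh Dx.
(* The explicit flux equals [vol * gradient] on the chart image, a neighbourhood of [x], so its
   derivative can be transferred. *)
have e0 : \forall y \near x, (g y ord_max ord_max * ext_d h c y ord0 -
    g y ord0 ord_max * ext_d h c y ord_max) * (Num.sqrt (w y))^-1 =
    vol u c y * gradient u h c y ord0.
  by apply: filterS (near_chart_img Dx) => y Dy; have [-> _] := vol_gradient h Dy.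
have e1 : \forall y \near x, (g y ord0 ord0 * ext_d h c y ord_max -
    g y ord0 ord_max * ext_d h c y ord0) * (Num.sqrt (w y))^-1 =
    vol u c y * gradient u h c y ord_max.
  by apply: filterS (near_chart_img Dx) => y Dy; have [_ ->] := vol_gradient h Dy.
have {}f0 := near_eq_is_derive e0 f0; have {}f1 := near_eq_is_derive e1 f1.
have [h00 h01 h10 h11] := inv_metricE Dx.
have p0 := @derive_val _ _ _ _ _ _ _ f0; have p1 := @derive_val _ _ _ _ _ _ _ f1.
have lapE : laplacian u h c x = (vol u c x)^-1 *
    (partial (fun y => vol u c y * gradient u h c y ord0) x ord0 +
     partial (fun y => vol u c y * gradient u h c y ord_max) x ord_max).
  by rewrite /laplacian /divergence sum_ord2.
apply: etrans lapE _.
apply: etrans (congr2 (fun a b => (vol u c x)^-1 * (a + b)) p0 p1) _.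
rewrite /dw /dg.
have gE v : dot (gradient_vector h x) v =
    (inv_metric u c x ord0 ord0 * ext_d h c x ord0 +
     inv_metric u c x ord0 ord_max * ext_d h c x ord_max) * dot v (ext_d u c x ord0) +
    (inv_metric u c x ord_max ord0 * ext_d h c x ord0 +
     inv_metric u c x ord_max ord_max * ext_d h c x ord_max) * dot v (ext_d u c x ord_max).
  by rewrite dot_gradient_vector /gradient 2!sum_ord2.
rewrite /vol det_metricE.
(* Everything is generalized before rewriting: otherwise unification unfolds
   the derivatives. *)
have we : g x ord0 ord0 * g x ord_max ord_max
  - g x ord0 ord_max * g x ord0 ord_max = w x by [].
move: (sqr_sqrtr (ltW w0)) we h00 h01 h10 h11 gE; rewrite det_metricE.
move: (w x) w0 r0 => W W0 r0 rr; rewrite /g.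
move: (gradient_vector h x) (inv_metric u c x) (metric u c x) => V I G.
(* Symmetry of the second derivatives of [u] lets the derivatives of the metric combine into
   Christoffel symbols. *)
have uC := d2_comm ord_max ord0 Dx.
move: (d2 u) uC => d2u uC; move: (d2 h) => d2h.
move: (Num.sqrt W) r0 rr (ext_d h c x) (ext_d u c x) => r r0 rr dh du.
move=> we h00 h01 h10 h11 gE.
rewrite [RHS]sum_ord2 2!sum_ord2 4!gE uC h00 h01 h10 h11.
move: (dot (d2u ord0 ord0 x)) (dot (d2u ord0 ord_max x)) (dot (d2u ord_max ord_max x)).
move=> a b e.
rewrite (sqrt_flux_sum _ _ _ _ _ _ r0 rr); have := lt0r_neq0 W0.
rewrite -we; clear - G a b e d2h dh du.
move: (G ord0 ord0) (G ord0 ord_max) (G ord_max ord_max) => p q s.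
move: (d2h ord0 ord0 x) (d2h ord0 ord_max x) (d2h ord_max ord0 x) (d2h ord_max ord_max x).
move: (a (du ord0)) (a (du ord_max)) (b (du ord0)) (b (du ord_max)).
move: (e (du ord0)) (e (du ord_max)) (dh ord0) (dh ord_max) => *.
by field.
Qed.

Lemma gradient_vector_loc (h : S -> R) x : D x ->
  dot (gradient_vector h x) (loc c u x) = 0.
Proof.
move=> Dx; rewrite dot_gradient_vector (dot_ext_d ord0 Dx) (dot_ext_d ord_max Dx).
by rewrite !mulr0 addr0.
Qed.

Lemma gradient_vector_ext_d (h : S -> R) x k : D x ->
  dot (gradient_vector h x) (ext_d u c x k) = ext_d h c x k.
Proof.
move=> Dx; rewrite dot_gradient_vector.
have dpos := det_metric_gt0 Dx; have [h00 h01 h10 h11] := inv_metricE Dx.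
have G i : dot (ext_d u c x k) (ext_d u c x i) = metric u c x k i by rewrite mxE.
have g10 : metric u c x ord_max ord0 = metric u c x ord0 ord_max.
  by rewrite -[in LHS]induced_metric_sym mxE.
rewrite (G ord0) (G ord_max) {G} /gradient 2!sum_ord2 {}h00 {}h01 {}h10 {}h11.
move: dpos g10; rewrite det_mx2.
move: (metric u c x) (ext_d h c x) => G dh dpos g10; rewrite g10 in dpos *.
have d0 := lt0r_neq0 dpos.
by case: (ord2P k) => ->; rewrite ?g10; field.
Qed.

(** * The trace-free symmetric matrix attached to a point of the fibre *)

Lemma trace_inv_metric (B : 'I_2 -> 'I_2 -> R) x : D x ->
  \sum_i \sum_j inv_metric u c x i j * B i j =
  (metric u c x ord_max ord_max * B ord0 ord0
   + metric u c x ord0 ord0 * B ord_max ord_max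
   - metric u c x ord0 ord_max * (B ord0 ord_max + B ord_max ord0))
  / \det (metric u c x).
Proof.
move=> Dx; have [h00 h01 h10 h11] := inv_metricE Dx.
rewrite sum_ord2 2!sum_ord2 h00 h01 h10 h11.
by move: (\det (metric u c x))^-1 (metric u c x) => d G; ring.
Qed.

(** This is the coefficient matrix obtained by differentiating the fibre equation
    [y . d_j u = d_j m] in the direction [i]. *)
Definition shape_mx (m : S -> R) (y : 'rV[R]_n.+1) (x : 'rV[R]_2) : 'M[R]_2 :=
  \matrix_(i, j) (d2 m i j x - dot y (d2 u i j x)).

Lemma shape_mx_sym m y x : smooth m -> D x -> (shape_mx m y x)^T = shape_mx m y x.
Proof.
move=> hm Dx; apply/matrixP => i j; rewrite !mxE.
by rewrite (d2_comm i j Dx) (d2_comm_real i j hm Dx).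
Qed.

(* The normal part of [y] contributes nothing by minimality, the component
   [m U] contributes [2 m], and the gradient part turns the Hessian of [m] into
   its covariant Hessian, of trace [- 2 m]. *)
Lemma shape_mx_trace m y x (G := metric u c x) (B := shape_mx m y x) :
  eigenfunction2 u m -> D x ->
  dot y (loc c u x) = loc c m x ->
  (forall k, dot y (ext_d u c x k) = ext_d m c x k) ->
  G ord_max ord_max * B ord0 ord0 + G ord0 ord0 * B ord_max ord_max
    - 2 * G ord0 ord_max * B ord0 ord_max = 0.
Proof.
move=> [sm lm] Dx yU ydu.
(* [nu] is the component of [y] normal to the surface inside the sphere, to which minimality
   applies. *)
pose nu := y - loc c m x *: loc c u x - gradient_vector m x.
have nuU : dot nu (loc c u x) = 0.
  by rewrite /nu !(dotDl, dotNl, dotZl) yU dot_loc mulr1 subrr sub0r gradient_vector_loc ?oppr0.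
have nudu i : dot nu (ext_d u c x i) = 0.
  rewrite /nu 2!dotDl 2!dotNl dotZl ydu dot_ext_d// gradient_vector_ext_d//.
  by rewrite mulr0 subr0 subrr.
have [_ _ _ /(_ c hc x Dx nu nuU nudu) Hnu] := hu.
have Hm := lm c hc x Dx; rewrite laplacianE// in Hm.
(* Splitting [y] writes [B] as the covariant Hessian of [m], plus [m] times the metric, minus the
   second fundamental form along [nu]. *)
have Hg i j : B i j = d2 m i j x - dot (gradient_vector m x) (d2 u i j x)
    + loc c m x * G i j - dot nu (d2 u i j x).
  have -> : B i j = d2 m i j x - dot y (d2 u i j x) by rewrite mxE.
  have -> : G i j = - dot (loc c u x) (d2 u i j x) by rewrite dot_d2// mxE opprK.
  rewrite /nu (_ : dot (y - _ - _) _ = dot y (d2 u i j x)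
    - loc c m x * dot (loc c u x) (d2 u i j x)
    - dot (gradient_vector m x) (d2 u i j x)); last by rewrite 2!dotDl 2!dotNl dotZl.
  move: (dot y _) (dot (loc c u x) _) (dot (gradient_vector m x) _) (loc c m x) (d2 m i j x).
  by move=> *; ring.
have dpos := det_metric_gt0 Dx.
have B10 : B ord_max ord0 = B ord0 ord_max.
  by have /matrixP/(_ ord0 ord_max) := shape_mx_sym y sm Dx; rewrite mxE.
have G10 : G ord_max ord0 = G ord0 ord_max.
  by have /matrixP/(_ ord0 ord_max) := induced_metric_sym x; rewrite mxE.
have d0 := lt0r_neq0 dpos.
pose q i j := d2 m i j x - dot (gradient_vector m x) (d2 u i j x).
pose p i j := dot nu (d2 u i j x).
have {}Hm : G ord_max ord_max * q ord0 ord0 + G ord0 ord0 * q ord_max ord_max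
    - G ord0 ord_max * (q ord0 ord_max + q ord_max ord0) = - 2 * loc c m x * \det G.
  by rewrite -Hm (trace_inv_metric q Dx) divfK.
have {}Hnu : G ord_max ord_max * p ord0 ord0 + G ord0 ord0 * p ord_max ord_max
    - G ord0 ord_max * (p ord0 ord_max + p ord_max ord0) = 0.
  by move/eqP: Hnu; rewrite (trace_inv_metric p Dx) mulf_eq0 invr_eq0 (negbTE d0) orbF => /eqP.
have {}Hg i j : B i j = q i j + loc c m x * G i j - p i j by exact: Hg.
have -> : G ord_max ord_max * B ord0 ord0 + G ord0 ord0 * B ord_max ord_max
    - 2 * G ord0 ord_max * B ord0 ord_max =
    G ord_max ord_max * B ord0 ord0 + G ord0 ord0 * B ord_max ord_max
    - G ord0 ord_max * (B ord0 ord_max + B ord_max ord0).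
  by rewrite B10; ring.
rewrite (Hg ord0 ord0) (Hg ord0 ord_max) (Hg ord_max ord0) (Hg ord_max ord_max).
move: Hm; rewrite det_mx2 G10; move: Hnu; clearbody p q G; clear.
move: (loc c m x) => M Hnu Hm.
move/eqP: Hm; rewrite -subr_eq0 => /eqP Hm.
by rewrite -[RHS](subr0 0) -{1}Hm -Hnu; ring.
Qed.

End surface_patch.

(** * The twisted cone *)

Section twisted_cone_patch.
Variables (R : realType) (n : nat) (S : oriented_surface R).
Variables (u : S -> 'rV[R]_n.+1) (f m : S -> R) (w : S -> 'rV[R]_n.+1).
Hypotheses (hu : minimal_immersion u) (hM : twisted_cone_data u f w)
  (hm : eigenfunction2 u m).
Variables (c : chart R S) (hc : atlas c).

Let X := cyl_loc c (twisted_cone u w).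
Let U := loc c u.
Let M := differential_mx u c.
Let J x := hodge_mx (metric u c x).
Let L (x : 'rV[R]_2) (t : R) : 'M[R]_2 := t%:M - loc c f x *: J x.
Let beta x k := hodge u (ext_d f) c x k.

Let su : smooth u. Proof. by case: hu. Qed.
Let sw : smooth w. Proof. by case: hM. Qed.
Let sm : smooth m. Proof. by case: hm. Qed.

Let rowM x k : row k (M x) = ext_d u c x k. Proof. exact: rowK. Qed.

(** Substituting the formula for [dw] collects the terms in [du] into [t - f J] applied to [du],
    leaving [beta] times [u]. *)
Lemma ext_d_cone x t k : chart_img c x ->
  ext_d w c x k + t *: ext_d u c x k = beta x k *: U x + row k (L x t *m M x).
Proof.
move=> Dx; have [_ _ ->//] := hM; rewrite -addrA; congr (_ + _).
have rowZ a (B : 'M[R]_(2, n.+1)) : row k (a *: B) = a *: row k B.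
  by apply/rowP => i; rewrite !mxE.
rewrite (hodgeE u c (ext_d u)) /L mulmxBl mul_scalar_mx linearB/= rowZ rowM.
rewrite addrC; congr (_ - _); rewrite -scalemxAl rowZ row_mul mulmx_sum_row.
by congr (_ *: _); apply: eq_bigr => i _; rewrite [in RHS]mxE rowM.
Qed.

Lemma is_derive_cone q v : chart_img c (base q) ->
  is_derive q v X ('D_(base v) (loc c w) (base q) +
    (height v *: U (base q) + height q *: 'D_(base v) U (base q))).
Proof.
move=> Dx.
have dw := smooth_differentiable_loc hc sw Dx.
have du := smooth_differentiable_loc hc su Dx.
have iw := is_derive_base (derivableP (diff_derivable (v := base v) dw)).
have iu := is_derive_base (derivableP (diff_derivable (v := base v) du)).
exact: (is_deriveD iw (is_derive_scale (is_derive_height q v) iu)).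
Qed.

Lemma partial_cone q (k : 'I_2) : chart_img c (base q) ->
  partial X q (lshift 1 k) =
  beta (base q) k *: U (base q) + row k (L (base q) (height q) *m M (base q)).
Proof.
move=> Dx; rewrite /partial (@derive_val _ _ _ _ _ _ _ (is_derive_cone _ Dx)).
rewrite base_delta height_delta_lshift scale0r add0r.
exact: ext_d_cone.
Qed.

Lemma partial_cone_max q : chart_img c (base q) ->
  partial X q ord_max = U (base q).
Proof.
move=> Dx; rewrite /partial (@derive_val _ _ _ _ _ _ _ (is_derive_cone _ Dx)).
by rewrite base_delta_max height_delta_max !derive0 scaler0 addr0 add0r scale1r.
Qed.

Lemma is_derive_height_mul q v : chart_img c (base q) ->
  is_derive q v (cyl_loc c (fun p => p.2 * m p.1))
    (height v * loc c m (base q) + height q * 'D_(base v) (loc c m) (base q)).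
Proof.
move=> Dx; have dm := smooth_differentiable_loc hc sm Dx.
have im := is_derive_base (derivableP (diff_derivable (v := base v) dm)).
have ih := is_derive_height q v.
apply: is_derive_eq (is_deriveM ih im) _.
by rewrite /GRing.scale/= addrC; congr (_ + _); exact: mulrC.
Qed.

Let LE x t k i : L x t k i = t *+ (k == i) - loc c f x * J x k i.
Proof. by rewrite /L; move: (J x) => B; rewrite !mxE. Qed.

(** This is [partial_cone] with [u] replaced by [m]: the form has the same coefficients [beta] and
    [L] as the derivatives of the cone, which is what makes the fibre equations simple. *)
Lemma cone_formE q (k : 'I_2) : chart_img c (base q) ->
  cone_form u f m c q (lshift 1 k) =
  loc c m (base q) * beta (base q) k
  + \sum_i L (base q) (height q) k i * ext_d m c (base q) i.
Proof.
move=> Dx; rewrite /cone_form /cyl_pullback /cyl_d /partial.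
rewrite (unsplitK (inl _ k)) (@derive_val _ _ _ _ _ _ _ (is_derive_height_mul _ Dx)).
rewrite base_delta height_delta_lshift mul0r add0r -!addrA; congr (_ + _).
rewrite (hodgeE u c (ext_d m)) mulr_sumr; apply/eqP; rewrite addrC eq_sym -subr_eq opprK.
rewrite -big_split/= (bigD1 k)//= big1 => [|i ik].
  rewrite addr0 LE eqxx mulr1n /GRing.scale/= /J.
  by rewrite -['D__ _ _]/(ext_d m c (base q) k); apply/eqP; ring.
by rewrite LE eq_sym (negbTE ik) /GRing.scale/= /J; ring.
Qed.

Lemma cone_formE_max q : chart_img c (base q) ->
  cone_form u f m c q ord_max = loc c m (base q).
Proof.
move=> Dx; rewrite /cone_form /cyl_pullback /cyl_d /partial.
rewrite (@derive_val _ _ _ _ _ _ _ (is_derive_height_mul _ Dx)).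
rewrite base_delta_max derive0 height_delta_max mulr0 addr0 mul1r.
case: fintype.splitP => [j /= e|j _]; last by rewrite add0r.
by have := ltn_ord j; rewrite -e.
Qed.

Let MU x : chart_img c x -> M x *m (U x)^T = 0.
Proof.
move=> Dx; apply/row_matrixP => i; rewrite row_mul rowM row0.
by apply/rowP => j; rewrite ord1 -dotE dotC dot_ext_d// mxE.
Qed.

Let UM x : chart_img c x -> U x *m (M x)^T = 0.
Proof. by move=> Dx; rewrite -[LHS]trmxK trmx_mul trmxK MU// trmx0. Qed.

Let UU x : U x *m (U x)^T = 1%:M.
Proof. by apply/matrixP => i j; rewrite !ord1 -dotE dot_loc// mxE. Qed.

Lemma unitmx_scalar_sub_hodge x t : chart_img c x -> 0 < t -> L x t \in unitmx.
Proof.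
move=> Dx t0; rewrite unitmxE unitfE det_scalar_sub_hodge_mx.
- by rewrite gt_eqF// ltr_wpDr ?sqr_ge0// exprn_gt0.
- exact: induced_metric_sym.
- exact: det_metric_gt0.
Qed.

(** In the frame formed by the rows of [M x] and [U x] the differential is block triangular, with
    diagonal blocks [L] and 1, and [L] is invertible because [t ^+ 2 + f ^+ 2] is positive. *)
Lemma immersion_cone q : cyl_img c q -> immersion_at X q.
Proof.
move=> [Dx t0]; rewrite /immersion_at.
set P := \matrix_i _; set x := base q in Dx.
have PE : P = col_mx ((\col_k beta x k) *m U x + L x (height q) *m M x) (U x)
    :> 'M[R]_(2 + 1, n.+1).
  apply/row_matrixP => i; case: (split_ordP i) => k ->.
    rewrite rowK -/x rowKu linearD/= !row_mul partial_cone// row_mul; congr (_ + _).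
    by apply/rowP => j; rewrite [RHS]mxE big_ord1 !mxE.
  rewrite ord1 rowKd row_id rowK (_ : rshift 2 0 = ord_max) ?partial_cone_max//.
  exact/val_inj.
have main (K : 'M[R]_2) (a : 'rV[R]_2) (b : 'rV[R]_1) : K \in unitmx ->
    row_mx a b *m col_mx ((\col_k beta x k) *m U x + K *m M x) (U x) = 0 ->
    row_mx a b = 0.
  move=> uK; rewrite mul_row_col => ab0.
  (* Multiplying by the transpose of [M x] removes the terms in [U x]; the Gram matrix and [K] are
     then cancelled. *)
  have a0 : a = 0.
    have uM : M x *m (M x)^T \in unitmx by rewrite -row_free_gram differential_mx_free.
    move: (congr1 (mulmxr (M x)^T) ab0); rewrite /= mul0mx mulmxDr !mulmxDl.
    rewrite -!mulmxA UM// !mulmx0 add0r addr0 !mulmxA -(mulmxA _ (M x)).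
    move/(congr1 (mulmxr (invmx (M x *m (M x)^T)))); rewrite /= mul0mx mulmxK//.
    by move/(congr1 (mulmxr (invmx K))); rewrite /= mul0mx mulmxK.
  move: ab0; rewrite a0 mul0mx add0r => /(congr1 (mulmxr (U x)^T)).
  by rewrite /= mul0mx -mulmxA UU mulmx1 => ->; rewrite row_mx0.
apply: inj_row_free => v; rewrite PE -[v](@hsubmxK _ 1 2 1).
by apply: main; exact: unitmx_scalar_sub_hodge.
Qed.

(* The tangential part of [y] is [m U] plus the gradient vector of [m]: the
   fibre over [q] does not depend on the height. *)
Lemma shifted_conormal_cone q y :
  shifted_conormal (cyl_img c) X (cone_form u f m c) (q, y) ->
  dot y (U (base q)) = loc c m (base q) /\
  forall k, dot y (ext_d u c (base q) k) = ext_d m c (base q) k.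
Proof.
move=> [/= [Dx t0] [xi [tau [xiN [_ tauT] ->]]]].
(* The conormal part pairs to zero, so only the sum [xi + tau] matters from here on. *)
have yX i : dot (xi + tau) (partial X q i) = cone_form u f m c q i.
  by rewrite dotDl tauT xiN add0r.
move: (xi + tau) yX => {xi tau xiN tauT} y yX.
have yU : dot y (U (base q)) = loc c m (base q).
  by rewrite -partial_cone_max// yX cone_formE_max.
split => // k; set x := base q in Dx yU *; pose t := height q.
(* The terms in [beta] agree on both sides because [y . u = m]; what remains is an equation
   multiplied by the invertible [L]. *)
have yL : L x t *m (M x *m y^T - \col_i ext_d m c x i) = 0.
  apply/colP => i; have := yX (lshift 1 i).
  rewrite partial_cone// cone_formE// dotDr dotZr yU mulrC => /addrI yLi.
  rewrite mulmxBr [LHS]mxE [X in _ + X]mxE mulmxA [RHS]mxE.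
  apply/eqP; rewrite subr_eq0; apply/eqP.
  transitivity (dot y (row i (L x t *m M x))).
    by rewrite dotC dotE -row_mul [RHS]mxE.
  by rewrite yLi [RHS]mxE; apply: eq_bigr => j _; rewrite [X in _ = _ * X]mxE.
have /eqP : M x *m y^T - \col_i ext_d m c x i = 0.
  rewrite -[LHS](mulKmx (unitmx_scalar_sub_hodge Dx t0)) -/t.
  by rewrite yL mulmx0.
rewrite subr_eq0 => /eqP/colP/(_ k); rewrite [RHS]mxE => <-.
by rewrite dotC dotE -rowM -row_mul [LHS]mxE.
Qed.

(** * Tangent vectors of the shifted conormal bundle *)

Lemma is_derive_base_curve (q : R -> 'rV[R]_3) t :
  derivable q t 1 -> is_derive t 1 (fun s => base (q s)) (base ('D_1 q t)).
Proof.
move=> dq; apply: is_derive_mxP => i j; have iq := derivableP dq.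
have -> : (fun s => base (q s) i j) = (fun s => q s i (lshift 1 j)).
  by apply/funext => s; rewrite mxE.
by rewrite [base _ _ _]mxE; exact: is_derive_mxE.
Qed.

(** The fibre equations hold along the whole curve near 0, so they can be differentiated there; [A]
    is the velocity of the base point. *)
Lemma shifted_conormal_tangent_cone p v :
  shifted_conormal_tangent (cyl_img c) X (cone_form u f m c) p v ->
  exists a (A : 'rV[R]_2),
  [/\ v.1 = a *: U (base p.1) + A *m (L (base p.1) (height p.1) *m M (base p.1)),
      v.2 *m (U (base p.1))^T = 0 &
      v.2 *m (M (base p.1))^T = A *m shape_mx u c m p.2 (base p.1)].
Proof.
case=> q [y [<- /= nqy dq dy ->]] /=.
have Hs : \forall s \near (0 : R), [/\ chart_img c (base (q s)),
    dot (y s) (U (base (q s))) = loc c m (base (q s)) &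
    forall k, dot (y s) (ext_d u c (base (q s)) k) = ext_d m c (base (q s)) k].
  apply: filterS nqy => s Hs; have [Ds _] := Hs.1.
  by have [? ?] := shifted_conormal_cone Hs; split.
have [Dx yU ydu] := nbhs_singleton Hs.
pose b s := base (q s); have ib := is_derive_base_curve dq; rewrite -/b in ib.
have [db b'] := ib; set A := base ('D_1 q 0) in ib b'.
set x := base (q 0) in Dx yU ydu *; set t := height (q 0).
have iy := derivableP dy.
have iloc (V : normedModType R) (h : S -> V) : smooth h ->
    is_derive (0 : R) 1 (fun s => loc c h (b s)) (\sum_i A 0 i *: ext_d h c x i).
  move=> sh; rewrite -b'.
  exact: (is_derive_curve (smooth_differentiable_loc hc sh Dx) db).
have id (V : normedModType R) (h : S -> V) k : smooth h ->
    is_derive (0 : R) 1 (fun s => ext_d h c (b s) k)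
      (\sum_i A 0 i *: partial (fun z => ext_d h c z k) x i).
  move=> sh; rewrite -b'.
  exact: (is_derive_curve (smooth_differentiable_ext_d hc k sh Dx) db).
have iX : is_derive (0 : R) 1 (X \o q) (\sum_i A 0 i *: ext_d w c x i +
    (height ('D_1 q 0) *: U x + t *: (\sum_i A 0 i *: ext_d u c x i))).
  have ih : is_derive (0 : R) 1 (fun s => height (q s)) (height ('D_1 q 0)).
    by apply: is_derive_mxE; exact: derivableP.
  exact: (is_deriveD (iloc _ _ sw) (is_derive_scale ih (iloc _ _ su))).
(* The multiple of [U] collects the [beta] terms of the horizontal velocity and the velocity of the
   height, whose direction in the cone is [U]. *)
exists (\sum_i A 0 i * beta x i + height ('D_1 q 0)), A; split.
- rewrite (@derive_val _ _ _ _ _ _ _ iX) mulmx_sum_row scalerDl scaler_suml.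
  rewrite scaler_sumr addrA [LHS]addrAC -big_split/= addrAC -big_split/=.
  congr (_ + _); apply: eq_bigr => i _.
  by rewrite -scalerA -scalerDr -(ext_d_cone _ _ Dx) scalerDr !scalerA (mulrC t).
- apply/matrixP => i j; rewrite !ord1 -dotE [RHS]mxE.
  have := is_deriveB (is_derive_dot iy (iloc _ _ su)) (iloc _ _ sm).
  move/near_cst_is_derive; rewrite dot_sumZr.
  (* At time 0 the second fibre equation cancels [y . du] against [dm], leaving only the pairing of
     the velocity of [y] with [U]. *)
  under eq_bigr do rewrite ydu.
  rewrite -addrA subrr addr0; apply.
  apply: filterS Hs => s [_ yUs _]; rewrite !fctE.
  by rewrite -[LHS]/(dot (y s) (U (base (q s))) - _) yUs yU !subrr.
- apply/rowP => k; rewrite [LHS]mxE [RHS]mxE.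
  have := is_deriveB (is_derive_dot iy (id _ _ k su)) (id _ _ k sm).
  move/near_cst_is_derive; rewrite dot_sumZr => H.
  rewrite (_ : \sum_j _ = dot ('D_1 y 0) (ext_d u c x k)); last first.
    by apply: eq_bigr => i _; rewrite !mxE.
  apply/eqP; rewrite -subr_eq0 -[X in _ == X]H; last first.
    apply: filterS Hs => s [_ _ yus]; rewrite !fctE.
    by rewrite -[LHS]/(dot (y s) (ext_d u c (base (q s)) k) - _) yus ydu !subrr.
  rewrite -addrA; apply/eqP; congr (_ + _); rewrite -sumrB -sumrN.
  apply: eq_bigr => i _; have -> : shape_mx u c m (y 0) x i k =
      partial (fun z => ext_d m c z k) x i
      - dot (y 0) (partial (fun z => ext_d u c z k) x i) by rewrite mxE.
  by rewrite mulrBr opprB.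
Qed.

Lemma twisted_cone_patch theta :
  sin (cophase n theta) = 0 ->
  twisted_austere_patch (cyl_img c) X (cone_form u f m c) theta.
Proof.
move=> sphi; split; first exact: immersion_cone.
move=> [q y] qy; have [[/= Dx t0] _] := qy.
have [yU ydu] := shifted_conormal_cone qy.
apply: (special_lagrangian_plane_of_block (U := U (base q)) (M := M (base q))
  (S := shape_mx u c m y (base q)) (t := height q) (f := loc c f (base q))) => //.
- exact: dot_loc.
- exact: MU.
- exact: differential_mx_free.
- exact: shape_mx_sym.
- by rewrite -metricE; exact: shape_mx_trace.
- by move=> v /shifted_conormal_tangent_cone; rewrite /L /J -metricE.
Qed.

End twisted_cone_patch.

Unset Implicit Arguments.

Theorem theorem5p7 (R : realType) (n : nat) (S : oriented_surface R)
  (u : S -> 'rV[R]_n.+1) (f m : S -> R) (w : S -> 'rV[R]_n.+1) (theta : R)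
  (hu : minimal_immersion u)
  (hM : twisted_cone_data u f w)
  (hm : eigenfunction2 u m)
  (* [tan] takes the junk value 0 where [cos] vanishes *)
  (hcos : cos (cophase n theta) != 0)
  (htan : tan (cophase n theta) = 0) :
  twisted_austere (twisted_cone u w) (cone_form u f m) theta.
Proof.
move=> c hc; apply: twisted_cone_patch => //.
by move/eqP: htan; rewrite /tan mulf_eq0 invr_eq0 (negbTE hcos) orbF => /eqP.
Qed.
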